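(* Let $\vec G_1$ and $\vec G_2$ be orientations of the Coxeter diagrams of finite Coxeter systems $(W_1,S_1)$ and $(W_2,S_2)$. An isomorphism (respectively anti-isomorphism) of directed diagrams $\vec G_1\to\vec G_2$ induces an isomorphism (respectively anti-isomorphism) of Cambrian lattices $\mathcal C(\vec G_1)\to\mathcal C(\vec G_2)$. Conversely, an isomorphism (respectively anti-isomorphism) of Cambrian lattices $\mathcal C(\vec G_1)\to\mathcal C(\vec G_2)$ restricts, on the atoms (which are the classes of the simple reflections, identified with the vertices of the diagrams), to an isomorphism (respectively anti-isomorphism) of directed diagrams.
   Context: The Coxeter diagram of $(W,S)$ has vertex set $S$ with an edge labeled $m(s,t)$ (order of $st$) whenever $m(s,t)>2$. An orientation assigns a direction to each edge. An isomorphism of directed diagrams is a bijection on vertices preserving edges, labels and directions; an anti-isomorphism preserves edges and labels and reverses all directions. The (right) weak order on $W$: $v\le w$ iff $I(v)\subseteq I(w)$, $I(w)$ the set of reflections $t$ with $\ell(tw)<\ell(w)$; it is a lattice for finite $W$. The Cambrian congruence $\Theta(\vec G)$ is the smallest lattice congruence of the weak order such that for each directed edge $s\to t$, $t$ is congruent to the element with reduced word $tsts\cdots$ having $m(s,t)-1$ letters. The Cambrian lattice $\mathcal C(\vec G)$ is the quotient lattice of the weak order modulo $\Theta(\vec G)$. *)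

(* Defs.v *)
From mathcomp Require Import all_boot all_order all_fingroup.
Set Implicit Arguments.
Unset Strict Implicit.
Unset Printing Implicit Defensive.

Local Open Scope group_scope.

Section Coxeter.
Variable gT : finGroupType.
Implicit Types (S : {set gT}) (x y w : gT).

Definition gpow (H : Type) (mul : H -> H -> H) (one : H) (a : H) (n : nat) : H :=
  iter n (mul a) one.

(* (W,S) is a Coxeter system, W being the whole group gT: S is a set of
   involutions generating W, and W has the Coxeter presentation
   < S | (s t)^m(s,t) = 1 >, with m(s,t) = #[s * t], expressed by its
   universal property with respect to arbitrary groups. *)
Definition coxeter_system S : Prop :=
  [/\ (1 : gT) \notin S,
      {in S, forall s, #[s] = 2%N},
      <<S>> = [set: gT] &
      forall (H : Type) (mul : H -> H -> H) (one : H) (inv : H -> H),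
        (forall a b c, mul a (mul b c) = mul (mul a b) c) ->
        (forall a, mul one a = a) ->
        (forall a, mul (inv a) a = one) ->
        forall f : gT -> H,
          {in S &, forall s t, gpow mul one (mul (f s) (f t)) #[s * t] = one} ->
          exists phi : gT -> H,
            (forall x y, phi (x * y) = mul (phi x) (phi y)) /\ {in S, phi =1 f}].

Definition word_ball S (k : nat) : {set gT} :=
  iter k (fun A => A * (1 |: S)) [set 1].

(* Coxeter length (correct whenever <<S>> = [set: gT]). *)
Definition coxlen S w : nat :=
  find (fun k => w \in word_ball S k) (iota 0 #|gT|.+1).

Definition reflections S : {set gT} := [set s ^ u | s in S, u in [set: gT]].

Definition inv_set S w : {set gT} :=
  [set t in reflections S | coxlen S (t * w) < coxlen S w].

Definition weak_le S v w : bool := inv_set S v \subset inv_set S w.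

Definition longest S : gT := [arg max_(w > (1 : gT)) coxlen S w].

Definition is_join (le : rel gT) x y z : Prop :=
  [/\ le x z, le y z & forall u, le x u -> le y u -> le z u].
Definition is_meet (le : rel gT) x y z : Prop :=
  [/\ le z x, le z y & forall u, le u x -> le u y -> le u z].

Definition lattice_congruence (le : rel gT) (R : gT -> gT -> Prop) : Prop :=
  [/\ (forall x, R x x), (forall x y, R x y -> R y x),
      (forall x y z, R x y -> R y z -> R x z),
      (forall x x' y y' z z', R x x' -> R y y' ->
          is_join le x y z -> is_join le x' y' z' -> R z z') &
      (forall x x' y y' z z', R x x' -> R y y' ->
          is_meet le x y z -> is_meet le x' y' z' -> R z z')].

Fixpoint alt_word (a b : gT) (k : nat) : gT :=
  if k is k'.+1 then a * alt_word b a k' else 1.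

(* O is an orientation of the Coxeter diagram of (W,S): O s t means the
   edge {s,t} is directed s -> t. *)
Definition orientation S (O : rel gT) : Prop :=
  (forall s t, O s t -> [/\ s \in S, t \in S & 2 < #[s * t]]%N) /\
  {in S &, forall s t, (2 < #[s * t])%N -> O s t = ~~ O t s}.

Definition cambrian_cong S (O : rel gT) (x y : gT) : Prop :=
  forall R : gT -> gT -> Prop,
    lattice_congruence (weak_le S) R ->
    (forall s t, O s t -> R t (alt_word t s #[s * t].-1)) ->
    R x y.

Definition quot_le (le : rel gT) (R : gT -> gT -> Prop) (x y : gT) : Prop :=
  exists x' y', [/\ R x x', R y y' & le x' y'].

End Coxeter.

(* f : gT1 -> gT2, acting on representatives, induces an isomorphism
   (resp. anti-isomorphism) of the quotient lattices (gT1,le1)/R1 -> (gT2,le2)/R2 *)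
Definition quot_iso (gT1 gT2 : finGroupType) (le1 : rel gT1) (R1 : gT1 -> gT1 -> Prop)
    (le2 : rel gT2) (R2 : gT2 -> gT2 -> Prop) (f : gT1 -> gT2) : Prop :=
  [/\ (forall x y, R1 x y <-> R2 (f x) (f y)),
      (forall y, exists x, R2 (f x) y) &
      (forall x y, quot_le le1 R1 x y <-> quot_le le2 R2 (f x) (f y))].

Definition quot_anti_iso (gT1 gT2 : finGroupType) (le1 : rel gT1) (R1 : gT1 -> gT1 -> Prop)
    (le2 : rel gT2) (R2 : gT2 -> gT2 -> Prop) (f : gT1 -> gT2) : Prop :=
  [/\ (forall x y, R1 x y <-> R2 (f x) (f y)),
      (forall y, exists x, R2 (f x) y) &
      (forall x y, quot_le le1 R1 x y <-> quot_le le2 R2 (f y) (f x))].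

Definition diag_iso (gT1 gT2 : finGroupType) (S1 : {set gT1}) (O1 : rel gT1)
    (S2 : {set gT2}) (O2 : rel gT2) (sigma : gT1 -> gT2) : Prop :=
  [/\ {in S1 &, injective sigma}, sigma @: S1 = S2,
      {in S1 &, forall s t, (2 < #[s * t]) = (2 < #[sigma s * sigma t])}%N,
      {in S1 &, forall s t, (2 < #[s * t])%N -> #[sigma s * sigma t] = #[s * t]} &
      {in S1 &, forall s t, O2 (sigma s) (sigma t) = O1 s t}]%g.

Definition diag_anti_iso (gT1 gT2 : finGroupType) (S1 : {set gT1}) (O1 : rel gT1)
    (S2 : {set gT2}) (O2 : rel gT2) (sigma : gT1 -> gT2) : Prop :=
  [/\ {in S1 &, injective sigma}, sigma @: S1 = S2,
      {in S1 &, forall s t, (2 < #[s * t]) = (2 < #[sigma s * sigma t])}%N,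
      {in S1 &, forall s t, (2 < #[s * t])%N -> #[sigma s * sigma t] = #[s * t]} &
      {in S1 &, forall s t, O2 (sigma t) (sigma s) = O1 s t}]%g.

Definition group_iso (gT1 gT2 : finGroupType) (phi : gT1 -> gT2) : Prop :=
  bijective phi /\ {morph phi : x y / (x * y)%g}.

(* Main.v *)
Require Import Defs.
From mathcomp Require Import all_boot all_order all_fingroup cyclic.

(** Left inversion sets satisfy I(xy) = I(x) + x I(y) x^-1 (symmetric
    difference); the universal property of the Coxeter presentation, applied to
    the semidirect product of the subsets of W by W, produces this cocycle, and
    the exchange property follows from it.

    For J = {s,t}, the map w |-> w_J is a lattice homomorphism onto the polygon
    [1, w_J]. Contracting there the side through t gives a congruence of the weak
    order, which contains the Cambrian congruence whenever t -> s is not an edge.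
    Hence in the Cambrian lattice the classes above [s], not above [t] and below
    the join of [s] and [t] are exactly [s], [st], .., with m(s,t)-1 of them if
    s -> t and one otherwise: the lattice determines the directed diagram.

    Right multiplication by w0 reverses the weak order and carries the Cambrian
    congruence of an orientation to that of the opposite orientation, which reduces
    anti-isomorphisms to isomorphisms. *)

Set Implicit Arguments.
Unset Strict Implicit.
Unset Printing Implicit Defensive.

Local Open Scope group_scope.

(** * The reflection cocycle *)

Lemma mem_word_ballS (gT : finGroupType) (J : {set gT}) k w :
  reflect (w \in word_ball J k \/
           exists2 v, v \in word_ball J k & exists2 s, s \in J & w = v * s)
          (w \in word_ball J k.+1).
Proof.
apply: (iffP mulsgP) => [[v s vk]|].
  case/setU1P=> [-> ->|sJ ->]; first by left; rewrite mulg1.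
  by right; exists v => //; exists s.
case=> [wk|[v vk [s sJ ->]]]; last by exists v s => //; rewrite setU1r.
by exists w 1; rewrite ?setU11 ?mulg1.
Qed.

Lemma word_ballS (gT : finGroupType) (J : {set gT}) k w :
  w \in word_ball J k -> w \in word_ball J k.+1.
Proof. by move=> wk; apply/mem_word_ballS; left. Qed.

Lemma word_ballMr (gT : finGroupType) (J : {set gT}) k w s :
  w \in word_ball J k -> s \in J -> w * s \in word_ball J k.+1.
Proof. by move=> wk sJ; apply/mem_word_ballS; right; exists w => //; exists s. Qed.

(** Through [gen_expgs], lets inductions over [<<J>>] run on word balls. *)
Lemma word_ball_expg (gT : finGroupType) (J : {set gT}) k :
  word_ball J k = (1 |: J) ^+ k.
Proof. by elim: k => [|k IHk] //=; rewrite expgSr -IHk. Qed.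

Lemma word_ball_gen (gT : finGroupType) (J : {set gT}) k : word_ball J k \subset <<J>>.
Proof.
apply/subsetP; elim: k => [|k IHk] w; first by move/set1P->.
case/mem_word_ballS=> [/IHk //|[v /IHk vJ [s sJ ->]]].
by rewrite groupM // mem_gen.
Qed.

Lemma gpow_expg (gT : finGroupType) (a : gT) n : gpow (@mulg gT) 1 a n = a ^+ n.
Proof. by elim: n => //= n IHn; rewrite expgS -IHn. Qed.

Lemma alt_wordS (gT : finGroupType) (a b : gT) k : alt_word a b k.+1 = a * alt_word b a k.
Proof. by []. Qed.

Lemma order_mulC (gT : finGroupType) (a b : gT) : #[a * b] = #[b * a].
Proof. by rewrite -(orderJ (a * b) a) conjgE !mulgA mulVg mul1g. Qed.

(** * Rotations and reflections generated by two involutions *)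

Section Dihedral.

Variables (gT : finGroupType) (s t : gT).
Hypotheses (s2 : s * s = 1) (t2 : t * t = 1).

Lemma invg_involution : s^-1 = s.
Proof. by apply: (mulgI s); rewrite mulgV. Qed.

Lemma mulgK_involution x : x * s * s = x.
Proof. by rewrite -mulgA s2 mulg1. Qed.

Lemma mulKg_involution x : s * (s * x) = x.
Proof. by rewrite mulgA s2 mul1g. Qed.

Lemma conj_rotation : (s * t) ^ s = (s * t)^-1.
Proof.
apply: (mulIg (s * t)); rewrite mulVg /conjg invg_involution !mulgA s2 mul1g.
by rewrite -(mulgA t) s2 mulg1 t2.
Qed.

Lemma expg_rotation_swap i : s * (t * s) ^+ i = (s * t) ^+ i * s.
Proof.
elim: i => [|i IHi]; first by rewrite !expg0 mulg1 mul1g.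
by rewrite expgSr mulgA IHi expgSr !mulgA.
Qed.

Lemma conj_expg_rotation i : s ^ ((s * t) ^- i) = (s * t) ^+ i.*2 * s.
Proof.
rewrite /conjg invgK -addnn expgD -!mulgA; congr (_ * _).
have <- : ((s * t) ^+ i) ^ s = (s * t) ^- i by rewrite conjXg conj_rotation expVgn.
by rewrite /conjg invg_involution mulKg_involution.
Qed.

End Dihedral.

Section Cocycle.

Variables (gT : finGroupType) (S : {set gT}).

(** The semidirect product law on subsets and elements: [(+)] is symmetric difference, and
    [g ^ a.2 \in b.1] says that [g] lies in the conjugate of [b.1] by the inverse of [a.2]. *)
Definition twisted_mul (a b : {set gT} * gT) : {set gT} * gT :=
  ([set g | (g \in a.1) (+) (g ^ a.2 \in b.1)], a.2 * b.2).
Definition twisted_inv (a : {set gT} * gT) : {set gT} * gT :=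
  ([set g | g ^ a.2^-1 \in a.1], a.2^-1).

Lemma gpow_twisted A x n g :
  (g \in (gpow twisted_mul (set0, 1) (A, x) n).1) =
  \big[addb/false]_(i < n) (g ^ (x ^+ i) \in A).
Proof.
elim: n g => [|n IHn] g; first by rewrite big_ord0 inE.
rewrite big_ord_recl expg0 conjg1 /= inE /=; congr (_ (+) _).
by rewrite IHn; apply: eq_bigr => i _; rewrite -conjgM -expgS.
Qed.

Lemma gpow_twisted2 A x n : (gpow twisted_mul (set0, 1) (A, x) n).2 = x ^+ n.
Proof. by elim: n => //= n IHn; rewrite expgS -IHn. Qed.

Lemma simple_mulgg : coxeter_system S -> {in S, forall s, s * s = 1}.
Proof. by case=> _ o2 _ _ s /o2 os; rewrite -expg2 -os expg_order. Qed.

Lemma big_addb_double (a : nat -> bool) n :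
  \big[addb/false]_(i < n) (a i.*2 (+) a i.*2.+1) = \big[addb/false]_(j < n.*2) a j.
Proof.
elim: n => [|n IHn]; first by rewrite !big_ord0.
by rewrite big_ord_recr /= IHn doubleS !big_ord_recr /= addbA.
Qed.

(* Over the alternating word of length 2m, each reflection occurs twice. *)
Lemma twisted_relation s t : s * s = 1 -> t * t = 1 ->
  gpow twisted_mul (set0, 1) (twisted_mul ([set s], s) ([set t], t)) #[s * t]
    = (set0, 1).
Proof.
move=> s2 t2; rewrite [twisted_mul _ _]/twisted_mul /=.
set A := [set g | _].
apply: injective_projections => /=; last by rewrite gpow_twisted2 expg_order.
apply/setP=> g; rewrite gpow_twisted inE.
(* The [i]-th factor of the power contributes the reflections of index [2i] (from [s]) and [2i+1]
   (from [t]). *)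
pose a j := g == (s * t) ^+ j * s.
rewrite (eq_bigr (fun i : 'I__ => a i.*2 (+) a i.*2.+1)); last first.
  move=> i _; rewrite !inE /a; congr (_ (+) _).
    by rewrite -conj_expg_rotation // -(inj_eq (conjg_inj ((s * t) ^- i))) conjgK.
  rewrite -conjgM -(inj_eq (conjg_inj (((s * t) ^+ i * s)^-1))) conjgK.
  congr (_ == _); rewrite invMg conjgM.
  have -> : t ^ s^-1 = (s * t) * s by rewrite conjgE invgK (invg_involution s2) mulgA.
  rewrite conjMg conj_expg_rotation // expgS mulgA; congr (_ * _).
  by congr (_ * _); apply/conjg_fixP/commgP/commuteV/commuteX.
rewrite big_addb_double -addnn big_split_ord /=.
set b := (X in X (+) _); set b' := (X in _ (+) X).
suff -> : b' = b by rewrite addbb.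
by apply: eq_bigr => i _; rewrite /a expgD expg_order mul1g.
Qed.

Lemma reflection_cocycle : coxeter_system S ->
  exists N : gT -> {set gT},
    (forall x y g, (g \in N (x * y)) = (g \in N x) (+) (g ^ x \in N y)) /\
    {in S, forall s, N s = [set s]}.
Proof.
move=> cS; have S2 := simple_mulgg cS; case: cS => _ _ genS univS.
case: (univS _ twisted_mul (set0, 1) twisted_inv _ _ _ (fun s => ([set s], s))).
- move=> a b c; apply: injective_projections => /=; last by rewrite mulgA.
  by apply/setP=> g; rewrite !inE /= addbA conjgM.
- case=> A x; apply: injective_projections => /=; last by rewrite mul1g.
  by apply/setP=> g; rewrite !inE /= conjg1.
- case=> A x; apply: injective_projections => /=; last by rewrite mulVg.
  by apply/setP=> g; rewrite !inE /= addbb.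
- by move=> s t sS tS; apply: twisted_relation; apply: S2.
move=> phi [phiM phiS]; exists (fun x => (phi x).1).
split=> [x y g|s /phiS-> //].
(* The second component of [phi] is an endomorphism fixing [S], hence the identity, so the twist in
   the product law is conjugation by [x] itself. *)
suff phi2 z : (phi z).2 = z by rewrite phiM inE phi2.
have: z \in <<S>> by rewrite genS inE.
case: (gen_expgs S) => n -> ; rewrite -word_ball_expg.
have phi1 : (phi 1).2 = 1.
  by apply: (mulgI (phi 1).2); rewrite mulg1 -[in RHS](mulg1 1) phiM.
elim: n z => [|n IHn] z; first by rewrite inE => /eqP->.
case/mem_word_ballS=> [/IHn //|[v /IHn phiv [s sS ->]]].
by rewrite phiM /= phiv phiS.
Qed.

End Cocycle.

(** * Inversion sets, length and the exchange property *)

Section InversionSets.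

Variables (gT : finGroupType) (S : {set gT}).
Hypothesis cS : coxeter_system S.

Section FromCocycle.

Variable N : gT -> {set gT}.
Hypothesis NM : forall x y g, (g \in N (x * y)) = (g \in N x) (+) (g ^ x \in N y).
Hypothesis NS : {in S, forall s, N s = [set s]}.

Let N1 : N 1 = set0.
Proof.
apply/setP=> g; rewrite inE; have := NM 1 1 g.
by rewrite mulg1 conjg1; case: (g \in N 1).
Qed.

Let N_mulr w s g : s \in S -> (g \in N (w * s)) = (g \in N w) (+) (g == s ^ w^-1).
Proof.
move=> sS; rewrite NM (NS sS) inE; congr (_ (+) _).
by rewrite -(inj_eq (conjg_inj w^-1)) conjgK.
Qed.

(** Strong exchange: [t] is either in [N v] already, or created by the last letter as [v s v^-1]; in
    the latter case [t * (v * s) = v], which deletes that letter. Working in balls over [J] keeps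
    the shortened word in [J]. *)
Let N_exchange (J : {set gT}) k w t :
  J \subset S -> w \in word_ball J k -> t \in N w -> t * w \in word_ball J k.-1.
Proof.
move=> /subsetP JS; elim: k w t => [|k IHk] w t /=.
  by move/set1P->; rewrite N1 inE.
case/mem_word_ballS=> [wk tw|[v vk [s sJ ->]]].
  case: k IHk wk => [_ /set1P wE|k IHk wk]; first by rewrite wE N1 inE in tw.
  exact/word_ballS/IHk.
rewrite N_mulr ?JS //; have [tv _|_ /= /eqP->] := boolP (t \in N v).
  case: k IHk vk => [_ /set1P vE|k IHk vk]; first by rewrite vE N1 inE in tv.
  by rewrite mulgA word_ballMr ?IHk.
by rewrite conjgE invgK -!mulgA mulKg (simple_mulgg cS) ?JS // mulg1.
Qed.

Let card_N_mulr w s : s \in S ->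
  #|N (w * s)| = if s ^ w^-1 \in N w then #|N w|.-1 else #|N w|.+1.
Proof.
move=> sS; case: ifP => h.
  rewrite (cardsD1 (s ^ w^-1) (N w)) h /=; apply: eq_card => g.
  by rewrite N_mulr // !inE; case: eqVneq => [->|]; rewrite ?h ?addbT ?addbF.
rewrite -[RHS]add1n -[1%N in RHS](congr1 (fun b => nat_of_bool (~~ b)) h) -cardsU1.
apply: eq_card => g.
by rewrite N_mulr // !inE; case: eqVneq => [->|]; rewrite ?h ?addbT ?addbF.
Qed.

Let card_N_ball k w : w \in word_ball S k -> #|N w| <= k.
Proof.
elim: k w => [|k IHk] w; first by move/set1P->; rewrite N1 cards0.
case/mem_word_ballS=> [/IHk/leqW //|[v /IHk vk [s sS ->]]].
rewrite card_N_mulr //; case: ifP => _; last by rewrite ltnS.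
by rewrite (leq_trans (leq_pred _)) // leqW.
Qed.

(** When the last letter removes a reflection, [v * s] is [v] multiplied on the left by an element
    of [N v], so exchange shortens the word. *)
Let ball_card_N (J : {set gT}) w :
  J \subset S -> w \in <<J>> -> w \in word_ball J #|N w|.
Proof.
move=> JS; have [n ->] := gen_expgs J; rewrite -word_ball_expg.
elim: n w => [|n IHn] w; first by move/set1P->; rewrite N1 cards0 inE.
case/mem_word_ballS=> [/IHn //|[v /IHn vn [s sJ ->]]].
have sS := subsetP JS s sJ.
rewrite card_N_mulr //; case: ifP => [h|_]; last exact: word_ballMr.
have -> : v * s = s ^ v^-1 * v by rewrite conjgE invgK mulgA mulgKV.
exact: N_exchange.
Qed.

Let coxlenE w : coxlen S w = #|N w|.
Proof.
have wS : w \in <<S>> by case: cS => _ _ -> _; rewrite inE.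
have wb := ball_card_N (subxx S) wS.
rewrite /coxlen; set P := fun k => _.
(* The range searched by [coxlen] is long enough, so [find] succeeds. *)
have Nlt : #|N w| < #|gT|.+1 by rewrite ltnS max_card.
have hP : has P (iota 0 #|gT|.+1).
  by apply/hasP; exists #|N w| => //; rewrite mem_iota.
apply/eqP; rewrite eqn_leq; apply/andP; split.
  rewrite leqNgt; apply/negP => /(before_find 0).
  by rewrite nth_iota // add0n /P wb.
apply: card_N_ball; have := nth_find 0 hP; rewrite nth_iota //.
by move: hP; rewrite has_find size_iota.
Qed.

Let N_lt t w : t \in N w -> #|N (t * w)| < #|N w|.
Proof.
move=> tw; have wS : w \in <<S>> by case: cS => _ _ -> _; rewrite inE.
have /card_N_ball := N_exchange (subxx S) (ball_card_N (subxx S) wS) tw.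
by move/leq_ltn_trans; apply; rewrite prednK //; apply/card_gt0P; exists t.
Qed.

(** For [t = u^-1 s u] the contributions of [u^-1] and [u] cancel and the one of the middle letter
    remains. *)
Let N_reflection t : t \in reflections S -> t \in N t.
Proof.
case/imset2P=> s u sS _ ->; rewrite {2}conjgE !NM (NS sS) inE.
have NV g : (g \in N u^-1) = (g ^ u^-1 \in N u).
  by have := NM u^-1 u g; rewrite mulVg N1 inE; case: (g \in N _); case: (_ \in N u).
by rewrite NV conjgK eqxx conjgE mulKg; case: (s \in N u).
Qed.

Let N_reflections w : N w \subset reflections S.
Proof.
have: w \in <<S>> by case: cS => _ _ -> _; rewrite inE.
have [n ->] := gen_expgs S; rewrite -word_ball_expg.
elim: n w => [|n IHn] w; first by move/set1P->; rewrite N1 sub0set.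
case/mem_word_ballS=> [/IHn //|[v /IHn/subsetP vn [s sS ->]]].
apply/subsetP => g; rewrite N_mulr //; have [/vn //|_ /eqP ->] := boolP (g \in N v).
by apply/imset2P; exists s v^-1; rewrite ?inE.
Qed.

(** A uniqueness statement: it gives inversion sets the cocycle rule, and later identifies their
    pullback along an isomorphism in [morph_inv_set]. *)
Lemma cocycle_inv_set w : inv_set S w = N w.
Proof.
apply/setP=> t; rewrite inE !coxlenE.
apply/andP/idP=> [[tR]|tw]; last by rewrite N_lt // (subsetP (N_reflections w)).
(* If [t] is not in [N w], it lies in [N (t * w)], and multiplication by [t] shortens [t * w] to
   [w]. *)
apply: contraLR => tw; rewrite -leqNgt ltnW //.
have t2 : t * t = 1.
  case/imset2P: tR => s u sS _ ->.
  by rewrite -conjMg (simple_mulgg cS) ?conj1g.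
have ttw : t \in N (t * w).
  by rewrite NM N_reflection //= conjgE mulKg.
by have := N_lt ttw; rewrite mulgA t2 mul1g.
Qed.

Lemma inv_set_cocycle :
  [/\ forall x y g, (g \in inv_set S (x * y)) =
        (g \in inv_set S x) (+) (g ^ x \in inv_set S y),
      {in S, forall s, inv_set S s = [set s]},
      forall (J : {set gT}) w, J \subset S -> w \in <<J>> -> w \in word_ball J #|inv_set S w|,
      forall k w, w \in word_ball S k -> #|inv_set S w| <= k &
      forall w, coxlen S w = #|inv_set S w|].
Proof.
split=> [x y g|s sS|J w JS wJ|k w wk|w]; rewrite ?cocycle_inv_set.
- exact: NM.
- exact: NS.
- exact: ball_card_N.
- exact: card_N_ball.
- exact: coxlenE.
Qed.

End FromCocycle.

Lemma inv_setM x y g :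
  (g \in inv_set S (x * y)) = (g \in inv_set S x) (+) (g ^ x \in inv_set S y).
Proof. by have [N [NM NS]] := reflection_cocycle cS; have [] := inv_set_cocycle NM NS. Qed.

Lemma inv_set_simple s : s \in S -> inv_set S s = [set s].
Proof.
by have [N [NM NS]] := reflection_cocycle cS; have [_ + _ _ _] := inv_set_cocycle NM NS; apply.
Qed.

Lemma mem_word_ball_inv_set (J : {set gT}) w :
  J \subset S -> w \in <<J>> -> w \in word_ball J #|inv_set S w|.
Proof.
by have [N [NM NS]] := reflection_cocycle cS; have [_ _ + _ _] := inv_set_cocycle NM NS; apply.
Qed.

Lemma card_inv_set_ball k w : w \in word_ball S k -> #|inv_set S w| <= k.
Proof.
by have [N [NM NS]] := reflection_cocycle cS; have [_ _ _ + _] := inv_set_cocycle NM NS; apply.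
Qed.

Lemma coxlen_card w : coxlen S w = #|inv_set S w|.
Proof. by have [N [NM NS]] := reflection_cocycle cS; have [] := inv_set_cocycle NM NS. Qed.

Lemma simple_generated w : w \in <<S>>.
Proof. by case: cS => _ _ -> _; rewrite inE. Qed.

Lemma inv_set1 : inv_set S 1 = set0.
Proof.
apply/setP=> g; rewrite in_set0; have := inv_setM 1 1 g.
by rewrite mulg1 conjg1; case: (g \in inv_set S 1).
Qed.

Lemma inv_set_eq0 w : inv_set S w = set0 -> w = 1.
Proof.
move=> w0; have := mem_word_ball_inv_set (subxx S) (simple_generated w).
by rewrite w0 cards0 => /set1P.
Qed.

Lemma inv_set_inj : injective (inv_set S).
Proof.
move=> x y xy; apply: (mulgI x^-1); rewrite mulVg; apply/esym/inv_set_eq0.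
by apply/setP=> g; rewrite inv_setM -xy -inv_setM mulVg inv_set1.
Qed.

Lemma inv_set_sub_reflections w : inv_set S w \subset reflections S.
Proof. by apply/subsetP=> g; rewrite inE => /andP[]. Qed.

Lemma simple_reflection s : s \in S -> s \in reflections S.
Proof. by move=> sS; apply/imset2P; exists s 1; rewrite ?inE ?conjg1. Qed.

Lemma inv_set_mulr w s g : s \in S ->
  (g \in inv_set S (w * s)) = (g \in inv_set S w) (+) (g == s ^ w^-1).
Proof.
move=> sS; rewrite inv_setM (inv_set_simple sS) in_set1; congr (_ (+) _).
by rewrite -(inj_eq (conjg_inj w^-1)) conjgK.
Qed.

(** Removing the last letter of a reduced word only shrinks the inversion set, by cardinality; the
    induction descends to the first letter. *)
Lemma inv_set_descent w : w != 1 -> exists2 s, s \in S & s \in inv_set S w.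
Proof.
have [n] := ubnP #|inv_set S w|; elim: n w => // n IHn w; rewrite ltnS => wn w1.
have := mem_word_ball_inv_set (subxx S) (simple_generated w).
case E: #|inv_set S w| => [|k] wk; first by case/set1P: wk w1 => ->; rewrite eqxx.
case/mem_word_ballS: wk => [/card_inv_set_ball|[v vk [s sS wE]]]; first by rewrite E ltnn.
have [v1|v1] := eqVneq v 1.
  by exists s => //; rewrite wE v1 mul1g inv_set_simple ?set11.
have vw : inv_set S v \subset inv_set S w.
  have sub : inv_set S w \subset s ^ v^-1 |: inv_set S v.
    apply/subsetP=> g; rewrite wE inv_set_mulr // in_setU1.
    by case: eqVneq => //=; rewrite addbF.
  have /eqP Ew : inv_set S w == s ^ v^-1 |: inv_set S v.
    rewrite eqEcard sub E cardsU1; case: (_ \notin _) => /=.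
      by rewrite add1n ltnS card_inv_set_ball.
    by rewrite add0n leqW // card_inv_set_ball.
  by rewrite Ew subsetUr.
have [|s' s'S s'v] := IHn v _ v1; last by exists s' => //; apply: (subsetP vw).
by rewrite (leq_trans _ wn) // E ltnS card_inv_set_ball.
Qed.

(** A simple reflection has a single inversion, so it is a word of length at most one in [J]. *)
Lemma simple_in_generated (J : {set gT}) s :
  J \subset S -> s \in S -> s \in <<J>> -> s \in J.
Proof.
move=> JS sS /(mem_word_ball_inv_set JS); rewrite (inv_set_simple sS) cards1.
case/mem_word_ballS=> [/set1P s1|[v /set1P-> [t tJ ->]]]; last by rewrite mul1g.
by case: cS => /negP[]; rewrite -s1.
Qed.

Lemma inv_set_generated (J : {set gT}) w :
  J \subset S -> w \in <<J>> -> inv_set S w \subset <<J>>.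
Proof.
move=> JS; have [n En] := gen_expgs J; rewrite {1}En -word_ball_expg.
elim: n w {En} => [|n IHn] w; first by move/set1P->; rewrite inv_set1 sub0set.
case/mem_word_ballS=> [/IHn //|[v vn [s sJ ->]]].
apply/subsetP=> g; rewrite inv_set_mulr ?(subsetP JS) //.
have [/(subsetP (IHn v vn)) //|_ /eqP-> ] := boolP (g \in inv_set S v).
by rewrite (groupJ (mem_gen sJ)) // groupV (subsetP (word_ball_gen J n)).
Qed.

End InversionSets.

(** * Duality, parabolic parts and rank two *)

Section OrderDuality.

Variables (T1 T2 : finGroupType) (le1 : rel T1) (le2 : rel T2).
Variables (f : T1 -> T2) (g : T2 -> T1).
Hypothesis gK : cancel g f.

(** By [gK] every competing bound is an image under [f], so the universal property transports;
    likewise in the next three lemmas. *)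
Lemma is_join_mono x y z : (forall u v, le2 (f u) (f v) = le1 u v) ->
  is_join le1 x y z -> is_join le2 (f x) (f y) (f z).
Proof.
move=> fle [xz yz h]; split; rewrite ?fle // => u.
by rewrite -(gK u) !fle; apply: h.
Qed.

Lemma is_meet_mono x y z : (forall u v, le2 (f u) (f v) = le1 u v) ->
  is_meet le1 x y z -> is_meet le2 (f x) (f y) (f z).
Proof.
move=> fle [xz yz h]; split; rewrite ?fle // => u.
by rewrite -(gK u) !fle; apply: h.
Qed.

Lemma is_join_anti x y z : (forall u v, le2 (f u) (f v) = le1 v u) ->
  is_join le1 x y z -> is_meet le2 (f x) (f y) (f z).
Proof.
move=> fle [xz yz h]; split; rewrite ?fle // => u.
by rewrite -(gK u) !fle; apply: h.
Qed.

Lemma is_meet_anti x y z : (forall u v, le2 (f u) (f v) = le1 v u) ->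
  is_meet le1 x y z -> is_join le2 (f x) (f y) (f z).
Proof.
move=> fle [xz yz h]; split; rewrite ?fle // => u.
by rewrite -(gK u) !fle; apply: h.
Qed.

Lemma lattice_congruence_mono R : (forall u v, le2 (f u) (f v) = le1 u v) ->
  lattice_congruence le2 R -> lattice_congruence le1 (fun x y => R (f x) (f y)).
Proof.
move=> fle [Rxx Rsym Rtr Rj Rm]; split=> //.
- by move=> x y /Rsym.
- by move=> x y z; apply: Rtr.
- by move=> x x' y y' z z' xx' yy' /(is_join_mono fle) + /(is_join_mono fle); apply: Rj.
- by move=> x x' y y' z z' xx' yy' /(is_meet_mono fle) + /(is_meet_mono fle); apply: Rm.
Qed.

Lemma lattice_congruence_anti R : (forall u v, le2 (f u) (f v) = le1 v u) ->
  lattice_congruence le2 R -> lattice_congruence le1 (fun x y => R (f x) (f y)).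
Proof.
move=> fle [Rxx Rsym Rtr Rj Rm]; split=> //.
- by move=> x y /Rsym.
- by move=> x y z; apply: Rtr.
- by move=> x x' y y' z z' xx' yy' /(is_join_anti fle) + /(is_join_anti fle); apply: Rm.
- by move=> x x' y y' z z' xx' yy' /(is_meet_anti fle) + /(is_meet_anti fle); apply: Rj.
Qed.

End OrderDuality.

Section WeakOrder.

Variables (gT : finGroupType) (S : {set gT}).
Hypothesis cS : coxeter_system S.
Local Notation I := (inv_set S).
Local Notation le := (weak_le S).
Local Notation w0 := (longest S).

Lemma weak_le_anti x y : le x y -> le y x -> x = y.
Proof. by move=> xy yx; apply: (inv_set_inj cS); apply/eqP; rewrite eqEsubset; apply/andP. Qed.

Lemma weak_le1 x : le 1 x.
Proof. by rewrite /weak_le (inv_set1 cS) sub0set. Qed.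

Lemma simple_le s w : s \in S -> le s w = (s \in I w).
Proof. by move=> sS; rewrite /weak_le (inv_set_simple cS) // sub1set. Qed.

Lemma simple_neq1 s : s \in S -> s != 1.
Proof. by case: cS => S1 _ _ _ sS; apply: contraNneq S1 => <-. Qed.

Lemma reflection_mulgg r : r \in reflections S -> r * r = 1.
Proof. by case/imset2P=> s u sS _ ->; rewrite -conjMg (simple_mulgg cS) ?conj1g. Qed.

Lemma reflection_inv_set r : r \in reflections S -> r \in I r.
Proof.
move=> rR; rewrite inE rR reflection_mulgg // !coxlen_card // (inv_set1 cS) cards0.
rewrite lt0n cards_eq0; apply/eqP => /(inv_set_eq0 cS) r1.
case/imset2P: rR r1 => s u sS _ -> /eqP.
by rewrite conjg_eq1; apply/negP/simple_neq1.
Qed.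

(** A reflection [r] missing from [I w0] would make [r * w0] longer than [w0]. *)
Lemma inv_set_longest : I w0 = reflections S.
Proof.
apply/eqP; rewrite eqEsubset inv_set_sub_reflections; apply/subsetP=> r rR.
have wmax w : coxlen S w <= coxlen S w0.
  by rewrite /longest; case: arg_maxnP => //= v _; apply.
apply: contraT => rw; suff: r \in I (r * w0).
  by rewrite inE rR mulgA reflection_mulgg // mul1g ltnNge wmax.
by rewrite (inv_setM cS) reflection_inv_set // conjgE mulKg (negbTE rw).
Qed.

Lemma reflectionJ g x : (g ^ x \in reflections S) = (g \in reflections S).
Proof.
have imp h u : h \in reflections S -> h ^ u \in reflections S.
  by case/imset2P=> s v sS _ ->; rewrite -conjgM; apply/imset2P; exists s (v * u); rewrite ?inE.
by apply/idP/idP=> /imp => [/(_ x^-1)|/(_ x)//]; rewrite conjgK.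
Qed.

Lemma inv_set_mulw0 x : I (x * w0) = reflections S :\: I x.
Proof.
apply/setP=> g; rewrite (inv_setM cS) inv_set_longest reflectionJ in_setD.
have := subsetP (inv_set_sub_reflections S x) g.
by case: (g \in I x) => [->//|_]; case: (g \in _).
Qed.

Lemma mulw0K : involutive (fun x => x * w0).
Proof.
move=> x; apply: (inv_set_inj cS); rewrite !inv_set_mulw0 setDDr setDv set0U.
exact/setIidPr/inv_set_sub_reflections.
Qed.

Lemma weak_le_mulw0 x y : le (x * w0) (y * w0) = le y x.
Proof.
have imp u v : le v u -> le (u * w0) (v * w0).
  by rewrite /weak_le !inv_set_mulw0; apply: setDS.
by apply/idP/idP=> /imp //; rewrite !mulw0K.
Qed.

Lemma mem_inv_mulw0 g x : g \in reflections S -> (g \in I (x * w0)) = (g \notin I x).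
Proof. by move=> gR; rewrite inv_set_mulw0 in_setD gR andbT. Qed.

(** Take [q] shortest in the coset [<<J>> :* w] and [p = w q^-1]. No reflection of [<<J>>] shortens
    [q], so by the cocycle rule the inversions of [w] in [<<J>>] all come from [p]. This [p] is the
    part written w_J. *)
Lemma parabolic_part (J : {set gT}) w : J \subset S ->
  exists2 p, p \in <<J>> & I p = I w :&: <<J>>.
Proof.
move=> JS; have ww : w \in <<J>> :* w by rewrite rcoset_refl.
case: (arg_minnP (fun q => coxlen S q) ww) => q qw qmin.
have qE : w * q^-1 \in <<J>>.
  by rewrite -groupV invMg invgK -mem_rcoset.
exists (w * q^-1) => //; apply/setP=> g; rewrite in_setI.
have sub := subsetP (inv_set_generated cS JS qE).
have [gJ|gJ] := boolP (g \in <<J>>); last by rewrite andbF; apply: contraNF gJ => /sub.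
rewrite andbT -[in RHS](mulgKV q w) (inv_setM cS (w * q^-1) q).
suff -> : g ^ (w * q^-1) \in I q = false by rewrite addbF.
have hJ : g ^ (w * q^-1) \in <<J>> by rewrite groupJ.
apply/negbTE; rewrite inE negb_and -leqNgt qmin ?orbT //.
by change (g ^ (w * q^-1) * q \in <<J>> :* w); rewrite mem_rcoset -mulgA groupM // -mem_rcoset.
Qed.

(** * Alternating words and the polygon of a pair of simple reflections *)

Section RotationsOfSimplePair.

Variables s t : gT.
Hypotheses (sS : s \in S) (tS : t \in S) (st : s != t).

Lemma order_gt1_simple : 1 < #[s * t].
Proof.
rewrite order_gt1; apply: contra st => /eqP/(canRL (mulgK t)).
by rewrite mul1g (invg_involution (simple_mulgg cS tS)) => ->.
Qed.

Lemma last_reflection : (s * t) ^+ #[s * t].-1 * s = t.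
Proof.
have s2 := simple_mulgg cS sS; have t2 := simple_mulgg cS tS.
apply: (mulgI (s * t)); rewrite mulgA -expgS prednK ?order_gt0 // expg_order mul1g.
by rewrite -mulgA t2 mulg1.
Qed.

Lemma rotation_inj i j : i < #[s * t] -> j < #[s * t] ->
  (s * t) ^+ i * s = (s * t) ^+ j * s -> i = j.
Proof.
by move=> im jm /mulIg/eqP; rewrite eq_expg_mod_order !modn_small // => /eqP.
Qed.

End RotationsOfSimplePair.

(** Stripping the first letter exchanges [s] and [t], and conjugation by [s] shifts the index by
    one. Up to length [#[s * t]] no reflection repeats, so the symmetric differences are disjoint
    unions. *)
Lemma mem_inv_alt_word s t k g : s \in S -> t \in S -> k <= #[s * t] ->
  reflect (exists2 i, i < k & g = (s * t) ^+ i * s) (g \in I (alt_word s t k)).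
Proof.
elim: k s t g => [|k IHk] s t g sS tS km.
  by rewrite /= (inv_set1 cS) in_set0; constructor; case.
have [s2 t2] := (simple_mulgg cS sS, simple_mulgg cS tS).
have sgs h : (g ^ s == h * t) = (g == s * h * t * s).
  rewrite conjgE (invg_involution s2) -(inj_eq (mulgI s)) -(inj_eq (mulIg s)).
  by rewrite (mulKg_involution s2) (mulgK_involution s2) !mulgA.
have stE i : (s * t) ^+ i.+1 * s = s * (t * s) ^+ i * t * s.
  by rewrite expg_rotation_swap // expgSr !mulgA.
have IH := IHk t s (g ^ s) tS sS; rewrite order_mulC in IH.
rewrite alt_wordS (inv_setM cS) (inv_set_simple cS sS) in_set1.
have {}IH := IH (ltnW km).
apply: (iffP idP) => [|[[|i] ik gE]].
- case: eqVneq => [->|_ /IH[i ik /eqP]]; first by exists 0; rewrite ?mul1g.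
  by rewrite sgs -stE => /eqP->; exists i.+1.
- rewrite mul1g in gE; have -> : (g == s) = true by exact/eqP.
  apply/negP => /= /IH[j jk /eqP]; rewrite sgs -stE gE -[X in X == _]mul1g -(expg0 (s * t)).
  by move/eqP/(rotation_inj (leq_ltn_trans (leq0n k) km) (leq_ltn_trans jk km)).
- have -> : g == s = false.
    apply/eqP=> gs; have : (s * t) ^+ i.+1 * s = (s * t) ^+ 0 * s by rewrite -gE mul1g.
    by move/(rotation_inj (leq_trans ik km) (leq_ltn_trans (leq0n k) km)).
  by apply/IH; exists i => //; apply/eqP; rewrite sgs -stE gE.
Qed.

Section AlternatingWords.

Variables s t : gT.
Hypotheses (sS : s \in S) (tS : t \in S).
Local Notation J := [set s; t].
Local Notation m := #[s * t].

Lemma alt_word_le k l : k <= l -> l <= m -> le (alt_word s t k) (alt_word s t l).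
Proof.
move=> kl lm; apply/subsetP=> g /mem_inv_alt_word[] //; first exact: leq_trans lm.
by move=> i ik ->; apply/mem_inv_alt_word => //; exists i => //; apply: leq_trans kl.
Qed.

Lemma card_inv_alt_word k : k <= m -> #|I (alt_word s t k)| = k.
Proof.
move=> km; rewrite -[RHS]card_ord.
rewrite -(card_imset _ (f := fun i : 'I_k => (s * t) ^+ i * s)); last first.
  by move=> i j /rotation_inj ij; apply/val_inj/ij => //; apply: leq_trans km.
apply: eq_card => g; apply/(mem_inv_alt_word _ sS tS km)/imsetP.
  by case=> i ik ->; exists (Ordinal ik).
by case=> i _ ->; exists i.
Qed.

Lemma first_in_alt_word k : k <= m -> (s \in I (alt_word s t k)) = (0 < k).
Proof.
move=> km; apply/(mem_inv_alt_word _ sS tS km)/idP => [[i + _]|k0].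
  exact: leq_ltn_trans.
by exists 0; rewrite ?mul1g.
Qed.

(** [t] is the reflection of index [m - 1], reached only by the full word. *)
Lemma last_in_alt_word k : k <= m -> (t \in I (alt_word s t k)) = (k == m).
Proof.
move=> km; apply/(mem_inv_alt_word _ sS tS km)/eqP => [[i ik]|->].
  rewrite -[LHS](last_reflection sS tS) => /rotation_inj h.
  apply/eqP; rewrite eqn_leq km /= -[m]prednK ?order_gt0 // h ?(leq_trans ik) //.
  by rewrite prednK ?order_gt0.
by exists m.-1; rewrite ?last_reflection ?prednK ?order_gt0.
Qed.

Lemma alt_word_in k : (alt_word s t k \in <<J>>) && (alt_word t s k \in <<J>>).
Proof.
elim: k => [|k /andP[h h']]; first by rewrite !group1.
by rewrite !alt_wordS !groupM // mem_gen // !inE eqxx ?orbT.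
Qed.

End AlternatingWords.

Lemma longest_alt_word s t : s \in S -> t \in S ->
  alt_word s t #[s * t] = alt_word t s #[s * t].
Proof.
have sub a b : a \in S -> b \in S -> le (alt_word a b #[a * b]) (alt_word b a #[a * b]).
  move=> aS bS; apply/subsetP=> g /mem_inv_alt_word[] // i im ->.
  apply/mem_inv_alt_word => //; first by rewrite order_mulC.
  (* Read from the other side of the polygon, index [i] becomes [m - 1 - i]. *)
  exists (#[a * b].-1 - i); first by rewrite -[X in _ < X]prednK ?order_gt0 // ltnS leq_subr.
  have [a2 b2] := (simple_mulgg cS aS, simple_mulgg cS bS).
  have -> : b * a = (a * b)^-1 by rewrite invMg !invg_involution.
  have -> : (a * b)^-1 ^+ (#[a * b].-1 - i) = (a * b) ^+ i.+1.
    apply: (mulgI ((a * b) ^+ (#[a * b].-1 - i))); rewrite -expgD expgVn mulgV.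
    have i_le : i <= #[a * b].-1 by rewrite -ltnS prednK ?order_gt0.
    by rewrite addnS subnK // prednK ?order_gt0 // expg_order.
  by rewrite expgSr -!mulgA b2 mulg1.
move=> sS tS; apply: weak_le_anti; first exact: sub.
by rewrite (order_mulC s t); apply: sub.
Qed.

(** Induction on left multiplication by a generator. A word of full length is first rewritten by the
    braid relation, so that its first letter cancels. *)
Lemma dihedral_elements s t p : s \in S -> t \in S -> p \in <<[set s; t]>> ->
  exists2 k, k <= #[s * t] & p = alt_word s t k \/ p = alt_word t s k.
Proof.
move=> sS tS; have [n ->] := gen_expgs [set s; t].
have step a b k : a \in S -> b \in S -> k <= #[a * b] -> exists2 l, l <= #[a * b] &
    a * alt_word a b k = alt_word a b l \/ a * alt_word a b k = alt_word b a l.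
  move=> aS bS; case: k => [_|k km]; first by exists 1%N; rewrite ?order_gt0 //; left.
  by exists k; [apply: ltnW | right; rewrite alt_wordS mulgA (simple_mulgg cS aS) mul1g].
have step' a b k : a \in S -> b \in S -> k <= #[a * b] -> exists2 l, l <= #[a * b] &
    a * alt_word b a k = alt_word a b l \/ a * alt_word b a k = alt_word b a l.
  move=> aS bS; rewrite leq_eqVlt => /predU1P[->|km]; last by exists k.+1 => //; left.
  by rewrite -longest_alt_word //; apply: step.
elim: n p => [|n IHn] p; first by move/set1P->; exists 0 => //; left.
rewrite expgS => /mulsgP[a v aJ /IHn[k km vE] ->].
have [ts sw] := (order_mulC s t, @or_comm).
case/setU1P: aJ => [->|/set2P[]->]; first by rewrite mul1g; exists k.
  by case: vE => ->; [apply: step | apply: step'].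
rewrite ts in km *; case: vE => ->.
  by have [l lm h] := step' t s k tS sS km; exists l => //; apply/or_comm.
by have [l lm h] := step t s k tS sS km; exists l => //; apply/or_comm.
Qed.

Section DihedralSubgroup.

Variables s t : gT.
Hypotheses (sS : s \in S) (tS : t \in S).
Local Notation J := [set s; t].
Local Notation m := #[s * t].

(** With the next two lemmas: the simple inversions of an element of [<<J>>] tell whether it is on a
    given side, at the top or at the bottom of the polygon. *)
Lemma dihedral_proper p : p \in <<J>> -> s \in I p -> t \notin I p ->
  exists2 k, 0 < k < m & p = alt_word s t k.
Proof.
move=> pJ sp tp; case: (dihedral_elements sS tS pJ) => k km [pE|pE].
  move: sp tp; rewrite pE first_in_alt_word // last_in_alt_word // => k0 kN.
  by exists k => //; rewrite k0 ltn_neqAle kN.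
rewrite order_mulC in km; move: sp tp; rewrite pE last_in_alt_word // => /eqP->.
by rewrite first_in_alt_word // order_gt0.
Qed.

Lemma dihedral_top p : p \in <<J>> -> s \in I p -> t \in I p -> p = alt_word s t m.
Proof.
move=> pJ sp tp; case: (dihedral_elements sS tS pJ) => k km [pE|pE].
  by move: tp; rewrite pE last_in_alt_word // => /eqP->.
rewrite order_mulC in km; move: sp; rewrite pE last_in_alt_word // => /eqP->.
by rewrite longest_alt_word // order_mulC.
Qed.

Lemma dihedral_bot p : p \in <<J>> -> s \notin I p -> t \notin I p -> p = 1.
Proof.
move=> pJ sp tp; case: (dihedral_elements sS tS pJ) => k km [pE|pE].
  by move: sp; rewrite pE first_in_alt_word // -leqNgt leqn0 => /eqP->.
rewrite order_mulC in km.
by move: tp; rewrite pE first_in_alt_word // -leqNgt leqn0 => /eqP->.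
Qed.

End DihedralSubgroup.

End WeakOrder.

(** * Polygon congruences *)

Section Congruences.

Variables (gT : finGroupType) (S : {set gT}).
Hypothesis cS : coxeter_system S.
Local Notation I := (inv_set S).
Local Notation le := (weak_le S).
Local Notation w0 := (longest S).
Local Notation part s t x := (I x :&: <<[set s; t]>>).

Definition meet_compatible (R : gT -> gT -> Prop) : Prop :=
  forall x x' y y' z z', R x x' -> R y y' -> is_meet le x y z -> is_meet le x' y' z' -> R z z'.

(** Multiplication by [w0] turns joins into meets, so compatibility with joins is compatibility with
    meets of the twisted relation. *)
Lemma lattice_congruence_by_duality (R : gT -> gT -> Prop) :
  (forall x, R x x) -> (forall x y, R x y -> R y x) ->
  (forall x y z, R x y -> R y z -> R x z) ->
  meet_compatible R -> meet_compatible (fun x y => R (x * w0) (y * w0)) ->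
  lattice_congruence le R.
Proof.
move=> Rxx Rsym Rtr Rm Rm0; split=> // x x' y y' z z' xx' yy'.
move=> /(is_join_anti (mulw0K cS) (weak_le_mulw0 cS)) j.
move=> /(is_join_anti (mulw0K cS) (weak_le_mulw0 cS)) j'.
by have := Rm0 _ _ _ _ _ _ _ _ j j'; rewrite !(mulw0K cS); apply.
Qed.

(** A simple [s] belongs to [I x] exactly when [s] is below [x]. *)
Lemma meet_simple s x y z : s \in S -> is_meet le x y z ->
  (s \in I z) = (s \in I x) && (s \in I y).
Proof.
move=> sS [zx zy h]; apply/idP/andP => [sz|[sx sy]].
  by rewrite (subsetP zx) // (subsetP zy).
by rewrite -(simple_le cS) //; apply: h; rewrite simple_le.
Qed.

(** It identifies the two ends of every Cambrian generator, so simple inversions are invariants of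
    Cambrian classes ([cambrian_descents]). *)
Lemma descents_congruence :
  lattice_congruence le (fun x y => {in S, forall s, (s \in I x) = (s \in I y)}).
Proof.
have mc : meet_compatible (fun x y => {in S, forall s, (s \in I x) = (s \in I y)}).
  move=> x x' y y' z z' xx' yy' m m' s sS.
  by rewrite (meet_simple sS m) (meet_simple sS m') xx' ?yy'.
apply: lattice_congruence_by_duality => //.
- by move=> x y xy s /xy.
- by move=> x y z xy yz s sS; rewrite xy ?yz.
have dual x y s : s \in S -> ((s \in I (x * w0)) = (s \in I (y * w0))) <-> ((s \in I x) = (s \in I y)).
  move=> /(simple_reflection (S := S)) sR; rewrite !(mem_inv_mulw0 cS) //.
  by split=> [/negb_inj|->].
move=> x x' y y' z z' xx' yy' m m' s sS; apply/dual => //.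
by apply: mc m m' s sS => s sS; apply/dual; rewrite ?xx' ?yy'.
Qed.

(* The kernel of w |-> w_J, for J = {s,t}, followed by the contraction of the
   interior of the side of [1, w_J] through t. *)
Definition polygon_cong s t x y : Prop :=
  part s t x = part s t y \/
  (t \in I x /\ s \notin I x) /\ (t \in I y /\ s \notin I y).

Lemma mem_part s t x : (s \in part s t x) = (s \in I x).
Proof. by rewrite in_setI (@mem_gen _ s) ?andbT // !inE eqxx. Qed.

Lemma partC s t x : part t s x = part s t x.
Proof. by rewrite [[set t; s]]setUC. Qed.

Lemma mem_part2 s t x : (t \in part s t x) = (t \in I x).
Proof. by rewrite -partC mem_part. Qed.

(** The part of the meet [z] is the inversion set of an element below the parts of [x] and [y],
    hence below [x'] and [y'], hence below their meet [z']; then by symmetry. *)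
Lemma part_meet s t x x' y y' z z' : s \in S -> t \in S ->
  part s t x = part s t x' -> part s t y = part s t y' ->
  is_meet le x y z -> is_meet le x' y' z' -> part s t z = part s t z'.
Proof.
move=> sS tS.
have sub u u' v v' w w' : part s t u = part s t u' -> part s t v = part s t v' ->
    is_meet le u v w -> is_meet le u' v' w' -> part s t w \subset part s t w'.
  move=> uu' vv' [wu wv _] [_ _ h].
  have JS : [set s; t] \subset S by apply/subsetP=> r /set2P[]->.
  have [p pJ pE] := parabolic_part cS w JS.
  rewrite subsetI subsetIr andbT -pE; apply: h; rewrite /weak_le pE.
    by rewrite (subset_trans (setSI _ wu)) // uu' subsetIl.
  by rewrite (subset_trans (setSI _ wv)) // vv' subsetIl.
move=> xx' yy' m m'; apply/eqP; rewrite eqEsubset.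
by rewrite (sub _ _ _ _ _ _ xx' yy' m m') (sub _ _ _ _ _ _ (esym xx') (esym yy') m' m).
Qed.

Lemma polygon_descents s t x y : polygon_cong s t x y ->
  (s \in I x) = (s \in I y) /\ (t \in I x) = (t \in I y).
Proof.
case=> [E|[[-> /negbTE->] [-> /negbTE->]] //].
by rewrite -2!(mem_part s t) -2!(mem_part2 s t) E.
Qed.

Lemma part_top s t x : s \in S -> t \in S -> s \in I x -> t \in I x ->
  part s t x = I (alt_word s t #[s * t]).
Proof.
move=> sS tS sx tx; have JS : [set s; t] \subset S by apply/subsetP=> r /set2P[]->.
have [p pJ pE] := parabolic_part cS x JS.
by rewrite -(dihedral_top cS sS tS pJ) pE ?mem_part ?mem_part2.
Qed.

Lemma part_bot s t x : s \in S -> t \in S -> s \notin I x -> t \notin I x ->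
  part s t x = set0.
Proof.
move=> sS tS sx tx; have JS : [set s; t] \subset S by apply/subsetP=> r /set2P[]->.
have [p pJ pE] := parabolic_part cS x JS.
by rewrite -(inv_set1 cS) -(dihedral_bot cS sS tS pJ) pE ?mem_part ?mem_part2.
Qed.

(** Cases on the simple inversions of [z]. If only [s] is below [z], it is below all arguments,
    which excludes the contracted side; if only [t] is, then [z] and [z'] are both on that side. *)
Lemma polygon_meet s t : s \in S -> t \in S -> meet_compatible (polygon_cong s t).
Proof.
move=> sS tS x x' y y' z z' xx' yy' m m'.
have [sx tx] := polygon_descents xx'; have [sy ty] := polygon_descents yy'.
have sz : (s \in I z) = (s \in I z') by rewrite (meet_simple sS m) (meet_simple sS m') sx sy.
have tz : (t \in I z) = (t \in I z') by rewrite (meet_simple tS m) (meet_simple tS m') tx ty.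
have [szT|szF] := boolP (s \in I z); have [tzT|tzF] := boolP (t \in I z).
- by left; rewrite !part_top -?sz -?tz.
- have /andP[sxT syT] : (s \in I x) && (s \in I y) by rewrite -(meet_simple sS m).
  left; apply: part_meet m m' => //.
    by case: xx' => // -[[_]]; rewrite sxT.
  by case: yy' => // -[[_]]; rewrite syT.
- by right; rewrite -sz -tz.
- by left; rewrite !part_bot -?sz -?tz.
Qed.

Lemma part_mulw0 s t x : part s t (x * w0) = part s t w0 :\: part s t x.
Proof.
rewrite (inv_set_mulw0 cS) (inv_set_longest cS).
apply/setP=> g; rewrite !(in_setI, in_setD).
by case: (g \in <<_>>); rewrite ?andbT ?andbF.
Qed.

Lemma part_mulw0_eq s t x y :
  part s t (x * w0) = part s t (y * w0) <-> part s t x = part s t y.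
Proof.
have imp u v : part s t u = part s t v -> part s t (u * w0) = part s t (v * w0).
  by rewrite !part_mulw0 => ->.
by split=> [/imp|/imp//]; rewrite !(mulw0K cS).
Qed.

(** Complementing inversions exchanges the two sides of the polygon. *)
Lemma polygon_mulw0 s t x y : s \in S -> t \in S ->
  polygon_cong s t (x * w0) (y * w0) <-> polygon_cong t s x y.
Proof.
move=> /(simple_reflection (S := S)) sR /(simple_reflection (S := S)) tR.
rewrite /polygon_cong !(mem_inv_mulw0 cS) // !negbK !(partC s t).
by split=> -[/part_mulw0_eq|[[? ?] [? ?]]]; by [left | right].
Qed.

Lemma polygon_lattice_congruence s t : s \in S -> t \in S ->
  lattice_congruence le (polygon_cong s t).
Proof.
move=> sS tS; apply: lattice_congruence_by_duality.
- by left.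
- by move=> x y [xy|[]]; [left; rewrite xy | right].
- move=> x y z [xy|[xx yy]] yz; last first.
    right; split=> //; case: (polygon_descents yz) => <- <- //.
  case: yz => [yz|[yy zz]]; first by left; rewrite xy.
  by right; split=> //; rewrite -(mem_part s t) -(mem_part2 s t) xy mem_part mem_part2.
- exact: polygon_meet.
- move=> x x' y y' z z' /polygon_mulw0-/(_ sS tS) xx' /polygon_mulw0-/(_ sS tS) yy' m m'.
  by apply/polygon_mulw0 => //; apply: polygon_meet m m'.
Qed.

Section Orientation.

Variable O : rel gT.
Hypothesis oO : orientation S O.

Lemma orientation_edge s t : O s t -> [/\ s \in S, t \in S, s != t & 2 < #[s * t]].
Proof.
move=> Ost; have [sS tS st] := oO.1 _ _ Ost; split=> //.
by apply: contraTneq st => ->; rewrite (simple_mulgg cS tS) order1.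
Qed.

Lemma cambrian_lattice_congruence : lattice_congruence le (cambrian_cong S O).
Proof.
split=> [x R [] //|x y xy R cR gR|x y z xy yz R cR gR||].
- by case: (cR) => _ h _ _ _; apply: h (xy R cR gR).
- by case: (cR) => _ _ h _ _; apply: h (xy R cR gR) (yz R cR gR).
- move=> x x' y y' z z' xx' yy' m m' R cR gR.
  by case: (cR) => _ _ _ h _; apply: h (xx' R cR gR) (yy' R cR gR) m m'.
- move=> x x' y y' z z' xx' yy' m m' R cR gR.
  by case: (cR) => _ _ _ _ h; apply: h (xx' R cR gR) (yy' R cR gR) m m'.
Qed.

Lemma cambrian_edge s t : O s t -> cambrian_cong S O t (alt_word t s #[s * t].-1).
Proof. by move=> Ost R cR gR; apply: gR. Qed.

(** The only simple reflections in [<<[set s; t]>>] are [s] and [t], and [s] appears only at full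
    length. *)
Lemma mem_inv_coatom s t r : O s t -> r \in S ->
  (r \in I (alt_word t s #[s * t].-1)) = (r == t).
Proof.
move=> /orientation_edge[sS tS st m2] rS.
have mp : #[s * t].-1 <= #[t * s] by rewrite order_mulC leq_pred.
have m0 : 0 < #[s * t].-1 by rewrite -ltnS prednK ?order_gt0 // ltnW.
have JS : [set s; t] \subset S by apply/subsetP=> h /set2P[]->.
apply/idP/eqP => [rx|->]; last by rewrite first_in_alt_word.
have /set2P[rE|//] : r \in [set s; t].
  apply: (simple_in_generated cS JS rS); apply: subsetP rx.
  by apply: inv_set_generated => //; case/andP: (alt_word_in s t #[s * t].-1).
move: rx; rewrite rE last_in_alt_word // order_mulC.
by rewrite -[X in _ == X]prednK ?order_gt0 // ltn_eqF.
Qed.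

Lemma cambrian_descents x y : cambrian_cong S O x y ->
  {in S, forall s, (s \in I x) = (s \in I y)}.
Proof.
move/(_ _ descents_congruence); apply=> s t Ost r rS.
have [sS tS _ _] := orientation_edge Ost.
by rewrite mem_inv_coatom // (inv_set_simple cS tS) in_set1.
Qed.

(** The part is a word [t u ..] whose inversions contain [t] but not [u]. With two letters or more
    it would contain [t u t], forcing [u] into [<<[set s; t]>>]. *)
Lemma part_coatom s t u : O s t -> u \in S -> u != t -> u != s ->
  part t u (alt_word t s #[s * t].-1) = part t u t.
Proof.
move=> Ost uS ut us; have [sS tS st m2] := orientation_edge Ost.
set x := alt_word _ _ _.
have JS : [set t; u] \subset S by apply/subsetP=> h /set2P[]->.
have JS' : [set s; t] \subset S by apply/subsetP=> h /set2P[]->.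
have [p pJ pE] := parabolic_part cS x JS.
have tx : t \in I x by rewrite mem_inv_coatom.
have ux : u \notin I x by rewrite mem_inv_coatom.
have [||[|[|k]] // km pk] := dihedral_proper cS tS uS pJ; rewrite ?pE ?mem_part ?mem_part2 //.
  rewrite -pE pk /= mulg1 (inv_set_simple cS tS); apply/esym/setIidPl.
  by rewrite sub1set mem_gen // set21.
have : t * u * t \in I p.
  by rewrite pk; apply/mem_inv_alt_word => //; [apply: ltnW; case/andP: km | exists 1%N].
rewrite pE => /setIP[+ _] => /(subsetP (inv_set_generated cS JS' _)).
case/andP: (alt_word_in s t #[s * t].-1) => _ -> /(_ isT) h.
have tJ : t \in <<[set s; t]>> by rewrite mem_gen // set22.
have uJ : u \in <<[set s; t]>> by rewrite -(groupMl _ tJ) -(groupMr _ tJ).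
by have /set2P[] := simple_in_generated cS JS' uS uJ => uE; rewrite uE eqxx in us ut.
Qed.

(** By minimality only the generators from edges [a -> b] matter. For the edge [s -> t] both ends
    are on the contracted side; if only [b] is in the pair, [part_coatom] applies; if [b] is outside
    it, both parts are trivial. The remaining case [t -> s] is excluded by hypothesis. *)
Lemma cambrian_polygon s t x y : s \in S -> t \in S -> s != t -> ~~ O t s ->
  cambrian_cong S O x y -> polygon_cong s t x y.
Proof.
move=> sS tS st Ots /(_ _ (polygon_lattice_congruence sS tS)); apply=> a b Oab; have [aS bS ab m2] := orientation_edge Oab.
have bI r : r \in S -> (r \in I b) = (r == b) by rewrite (inv_set_simple cS) // in_set1.
have xI r := mem_inv_coatom (r := r) Oab.
have [bt|bt] := eqVneq b t.
  have [as'|as'] := eqVneq a s.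
    by right; rewrite !bI ?xI // bt eqxx st.
  by left; rewrite -!(partC s t) -bt part_coatom // 1?eq_sym // bt eq_sym.
have [bs|bs] := eqVneq b s.
  left; rewrite -bs part_coatom // ?bs 1?eq_sym //.
  by apply: contraNneq Ots => ta; rewrite -bs -ta.
by left; rewrite !part_bot // ?bI ?xI // eq_sym.
Qed.

End Orientation.

End Congruences.

(** * The Cambrian quotient *)

Section CambrianOrder.

Variables (gT : finGroupType) (S : {set gT}).
Hypothesis cS : coxeter_system S.
Local Notation I := (inv_set S).
Local Notation le := (weak_le S).
Local Notation w0 := (longest S).

(** Meet both [x] and [z] with [y]. *)
Lemma congruence_convex R x y z :
  lattice_congruence le R -> le x y -> le y z -> R x z -> R x y.
Proof.
case=> Rxx _ _ _ Rm xy yz xz; apply: (Rm _ _ _ _ _ _ xz (Rxx y)); split=> //.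
- exact: subxx.
- exact: subxx.
Qed.

Lemma quot_le_anti R x y : lattice_congruence le R ->
  quot_le le R x y -> quot_le le R y x -> R x y.
Proof.
case=> Rxx Rsym Rtr _ Rm [x1 [y1 [xx1 yy1 le1]]] [y2 [x2 [yy2 xx2 le2]]].
have x12 : R x1 x2 by apply: Rtr (Rsym _ _ xx1) xx2.
have y12 : R y1 y2 by apply: Rtr (Rsym _ _ yy1) yy2.
(* The meet of [x1] and [y1] is [x1], that of [x2] and [y2] is [y2]. *)
have x1y2 : R x1 y2 by apply: (Rm _ _ _ _ _ _ x12 y12); split=> //; exact: subxx.
exact: Rtr (Rtr _ _ _ xx1 x1y2) (Rsym _ _ yy2).
Qed.

Lemma quot_le_cong R x x' y y' : lattice_congruence le R ->
  R x x' -> R y y' -> quot_le le R x y -> quot_le le R x' y'.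
Proof.
case=> _ Rsym Rtr _ _ xx yy [u [v [xu yv uv]]].
by exists u, v; split=> //; [apply: Rtr (Rsym _ _ xx) xu | apply: Rtr (Rsym _ _ yy) yv].
Qed.

Lemma quot_le_of_le R x y : lattice_congruence le R -> le x y -> quot_le le R x y.
Proof. by case=> Rxx _ _ _ _ xy; exists x, y. Qed.

Lemma alt_word_longest_le s t x : s \in S -> t \in S ->
  s \in I x -> t \in I x -> le (alt_word s t #[s * t]) x.
Proof. by move=> sS tS sx tx; rewrite /weak_le -(part_top cS sS tS sx tx) subsetIl. Qed.

Lemma orientation_op O : orientation S O -> orientation S (fun s t => O t s).
Proof.
case=> O1 O2; split=> [s t /O1[]|s t sS tS]; rewrite (order_mulC s t) //.
by move/(O2 t s tS sS).
Qed.

(* w |-> w w0 carries the bottom interval [1, w_J], J = {s,t}, to the top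
   interval of the same type: with x = (ts..)_(m-1) and z = (st..)_(m-1),
   joining s == z with x w0 gives x w0 == t w0. *)
Lemma cambrian_dual O x y : orientation S O ->
  cambrian_cong S O x y -> cambrian_cong S (fun s t => O t s) (x * w0) (y * w0).
Proof.
move=> oO xy R cR gR.
apply: (xy (fun u v => R (u * w0) (v * w0))).
  exact: (lattice_congruence_anti (f := fun u => u * w0) (mulw0K cS) (fun u v => weak_le_mulw0 cS u v) cR).
move=> s t Ost; have [sS tS st m2] := orientation_edge cS oO Ost.
set v := alt_word t s _; pose z := alt_word s t #[t * s].-1.
have Rsz : R s z by apply: gR.
case: (cR) => Rxx Rsym _ Rj _; apply: Rsym.
have [sR tR] := (simple_reflection sS, simple_reflection tS).
have mp : #[s * t].-1 <= #[t * s] by rewrite order_mulC leq_pred.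
have mp' : #[t * s].-1 <= #[s * t] by rewrite order_mulC leq_pred.
have predS : #[t * s].-1.+1 = #[t * s] by rewrite prednK ?order_gt0.
have sv : s \notin I v by rewrite (mem_inv_coatom cS oO) // (negbTE st).
have tv : t \in I v by rewrite (mem_inv_coatom cS oO).
have tz : t \notin I z.
  by rewrite last_in_alt_word // (order_mulC s t) -[X in _ == X]predS ltn_eqF.
apply: (Rj s z _ _ _ _ Rsz (Rxx (v * w0))).
  split=> //; last by exact: subxx.
  by rewrite (simple_le cS) // (mem_inv_mulw0 cS).
split=> [||u zu vu].
- apply/subsetP=> g gz; have gR' := subsetP (inv_set_sub_reflections S z) g gz.
  rewrite (mem_inv_mulw0 cS) // (inv_set_simple cS tS) in_set1.
  by apply: contraNneq tz => <-.
- by rewrite (weak_le_mulw0 cS) (simple_le cS).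
(* The join must contain every reflection except [t]: those outside [I v] are in [I (v * w0)], and
   those in [I v] have index below [m - 1] in [s t s ..], hence are in [I z]. *)
apply/subsetP=> g; rewrite (inv_set_mulw0 cS) in_setD (inv_set_simple cS tS) in_set1.
case/andP=> gt gR'; have [gv|gv] := boolP (g \in I v); last first.
  by apply: (subsetP vu); rewrite (mem_inv_mulw0 cS).
apply: (subsetP zu); have : g \in I (alt_word s t #[s * t]).
  rewrite (longest_alt_word cS sS tS); apply: subsetP gv.
  by apply: (alt_word_le cS) => //; rewrite ?leq_pred // order_mulC.
case/(mem_inv_alt_word cS g sS tS (leqnn _)) => i im gE.
apply/(mem_inv_alt_word cS g sS tS mp'); exists i => //.
move: im; rewrite (order_mulC s t) -predS ltnS leq_eqVlt => /predU1P[iE|//].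
case/eqP: gt; rewrite gE -[RHS](last_reflection cS sS tS).
by rewrite iE (order_mulC t s).
Qed.

Lemma cambrian_quot_anti_iso O : orientation S O ->
  quot_anti_iso le (cambrian_cong S (fun s t => O t s)) le (cambrian_cong S O)
    (fun x => x * w0).
Proof.
move=> oO; have oO' := orientation_op oO.
have dual x y : cambrian_cong S (fun s t => O t s) x y <->
    cambrian_cong S O (x * w0) (y * w0).
  split=> [/(cambrian_dual oO') //|/(cambrian_dual oO)].
  by rewrite !(mulw0K cS).
split=> // [y|x y].
  by exists (y * w0); rewrite (mulw0K cS) => R [].
split=> [[u [v [xu yv uv]]]|[v [u [yv xu uv]]]].
  by exists (v * w0), (u * w0); rewrite (weak_le_mulw0 cS); split=> //; apply/dual.
exists (u * w0), (v * w0); rewrite (weak_le_mulw0 cS); split=> //; apply/dual;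
  by rewrite (mulw0K cS).
Qed.

Section Orientation.

Variable O : rel gT.
Hypothesis oO : orientation S O.
Local Notation Theta := (cambrian_cong S O).
Local Notation qle := (quot_le le Theta).
Let cTheta : lattice_congruence le Theta := cambrian_lattice_congruence S O.

Lemma quot_le_simple s x : s \in S -> qle s x <-> s \in I x.
Proof.
move=> sS; split=> [[s' [x' [ss' xx' /subsetP sx]]]|]; last first.
  by rewrite -(simple_le cS) // => /(quot_le_of_le cTheta).
rewrite (cambrian_descents cS oO xx') // sx //.
by rewrite -(cambrian_descents cS oO ss') // (inv_set_simple cS sS) set11.
Qed.

Lemma cambrian_eq1 x : Theta x 1 -> x = 1.
Proof.
move=> x1; apply/eqP; apply: contraT => /(inv_set_descent cS)[s sS].
by rewrite (cambrian_descents cS oO x1) // (inv_set1 cS) in_set0.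
Qed.

Lemma cambrian_simple_inj s t : s \in S -> t \in S -> Theta s t -> s = t.
Proof.
move=> sS tS /(cambrian_descents cS oO)/(_ _ sS).
by rewrite !(inv_set_simple cS) // set11 in_set1 => /esym/eqP.
Qed.

(** A simple inversion of [x] is also one of [s], so it is [s]; then [s] is below [x'], which is
    below [s'], and convexity concludes. *)
Lemma quot_le_atom s x : s \in S -> qle x s -> x != 1 -> Theta x s.
Proof.
move=> sS [x' [s' [xx' ss' xs]]] /(inv_set_descent cS)[a aS ax].
have [_ Tsym Ttr _ _] := cTheta.
have ax' : a \in I x' by rewrite -(cambrian_descents cS oO xx').
have : a \in I s by rewrite (cambrian_descents cS oO ss') // (subsetP xs).
rewrite (inv_set_simple cS sS) => /set1P aE; rewrite aE in ax'.
apply: Ttr xx' _; apply: Tsym; apply: congruence_convex xs ss' => //.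
by rewrite simple_le.
Qed.

(** As [x'] is below [y'], which is congruent to the polygon top, [x'] is congruent to its meet with
    that top. This meet is the part of [x'], lying strictly inside the side through [s]. *)
Lemma cambrian_interval s t x : s \in S -> t \in S ->
  s \in I x -> t \notin I x -> qle x (alt_word s t #[s * t]) ->
  exists2 k, 0 < k < #[s * t] & Theta x (alt_word s t k).
Proof.
move=> sS tS sx tx [x' [y' [xx' yy' xy]]].
rewrite (cambrian_descents cS oO xx') // in sx.
rewrite (cambrian_descents cS oO xx') // in tx.
have [Trefl Tsym Ttr _ Tm] := cTheta.
have JS : [set s; t] \subset S by apply/subsetP=> r /set2P[]->.
have [p pJ pE] := parabolic_part cS x' JS.
have [||k km pk] := dihedral_proper cS sS tS pJ; rewrite ?pE ?mem_part ?mem_part2 //.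
exists k => //; apply: Ttr xx' _; rewrite -pk.
apply: (Tm _ _ _ _ _ _ (Trefl x') (Tsym _ _ yy')).
  by split=> //; exact: subxx.
split=> [||u ux uw].
- by rewrite /weak_le pE subsetIl.
- by case/andP: km => _ /ltnW km; rewrite pk; exact: (alt_word_le cS).
rewrite /weak_le pE subsetI; apply/andP; split=> //.
apply: subset_trans uw (inv_set_generated cS JS _).
by case/andP: (alt_word_in s t #[s * t]).
Qed.

(** The congruence is contained in [polygon_cong s t], which leaves the side through [s] intact;
    there the number of inversions recovers the length. *)
Lemma alt_word_separated s t k l : s \in S -> t \in S -> s != t -> ~~ O t s ->
  k < #[s * t] -> l < #[s * t] -> Theta (alt_word s t k) (alt_word s t l) -> k = l.
Proof.
move=> sS tS st Ots km lm /(cambrian_polygon cS oO sS tS st Ots).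
have JS : [set s; t] \subset S by apply/subsetP=> r /set2P[]->.
have partE i : I (alt_word s t i) :&: <<[set s; t]>> = I (alt_word s t i).
  by apply/setIidPl/inv_set_generated => //; case/andP: (alt_word_in s t i).
case=> [|[[+ _] _]]; last by rewrite last_in_alt_word ?(ltnW km) // ltn_eqF.
rewrite !partE => E; rewrite -(card_inv_alt_word cS sS tS (ltnW km)) E.
by rewrite card_inv_alt_word // ltnW.
Qed.

(** If [m <= 2] then [k = 1]. Otherwise the edge is [t -> s], its generator identifies the ends of
    this side, and convexity collapses the rest. *)
Lemma alt_word_contracted s t k : s \in S -> t \in S -> ~~ O s t ->
  0 < k < #[s * t] -> Theta s (alt_word s t k).
Proof.
move=> sS tS Ost /andP[k0 km]; have [Trefl _ _ _ _] := cTheta.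
have [m2|m2] := ltnP 2 #[s * t]; last first.
  case: k k0 km => // -[|k] _ km; first by rewrite /= mulg1.
  by have := leq_trans km m2; rewrite ltnS.
have Ots : O t s by move: (oO.2 s t sS tS m2); rewrite (negbTE Ost) => /esym/negbFE.
have := cambrian_edge (S := S) Ots; rewrite order_mulC => sc.
apply: (congruence_convex cTheta _ _ sc).
  by rewrite simple_le // first_in_alt_word // ltnW.
by apply: (alt_word_le cS) => //; rewrite ?leq_pred // -ltnS prednK ?order_gt0.
Qed.

End Orientation.

End CambrianOrder.

(** * Diagram isomorphisms and lattice isomorphisms *)

Section Transport.

Variables (gT1 gT2 : finGroupType) (S1 : {set gT1}) (S2 : {set gT2}).
Hypotheses (cS1 : coxeter_system S1) (cS2 : coxeter_system S2).

Lemma morph_fixing_generators (h : gT1 -> gT1) :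
  {morph h : x y / x * y} -> {in S1, h =1 id} -> h =1 id.
Proof.
move=> hM hS z; have : z \in <<S1>> by apply: simple_generated.
have [n ->] := gen_expgs S1; rewrite -word_ball_expg.
elim: n z => [|n IHn] z.
  by move/set1P->; apply: (mulgI (h 1)); rewrite -hM !mulg1.
by case/mem_word_ballS=> [/IHn //|[v /IHn hv [s sS ->]]]; rewrite hM hv hS.
Qed.

Lemma coxeter_morph (sigma : gT1 -> gT2) :
  {in S1 &, forall s t, #[sigma s * sigma t] = #[s * t]} ->
  exists2 phi : gT1 -> gT2, {morph phi : x y / x * y} & {in S1, phi =1 sigma}.
Proof.
move=> os; case: cS1 => _ _ _ univ.
have [||| |phi [phiM phiS]] := univ gT2 (@mulg _) 1 (@invg _) _ _ _ sigma.
- exact: mulgA.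
- exact: mul1g.
- exact: mulVg.
- by move=> s t sS tS; rewrite gpow_expg -os // expg_order.
by exists phi.
Qed.

Variables (phi : gT1 -> gT2) (psi : gT2 -> gT1).
Hypotheses (phiK : cancel phi psi) (phiM : {morph phi : x y / x * y}).
Hypothesis (phiS : {in S1, forall s, phi s \in S2}).

(** The pullback of inversion sets along [phi] is a cocycle with the right values on [S1], so
    uniqueness applies. *)
Lemma morph_inv_set x r : (phi r \in inv_set S2 (phi x)) = (r \in inv_set S1 x).
Proof.
pose N y := [set r | phi r \in inv_set S2 (phi y)].
have NE y g : (g \in N y) = (phi g \in inv_set S2 (phi y)) by rewrite in_set.
rewrite -NE (cocycle_inv_set cS1 (N := N)) // => [u v g|s sS].
  have phiJ : phi (g ^ u) = phi g ^ phi u.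
    by apply: (mulgI (phi u)); rewrite -conjgC -!phiM -conjgC.
  by rewrite !NE phiM (inv_setM cS2) phiJ.
apply/setP=> g; rewrite NE (inv_set_simple cS2) ?phiS //.
by rewrite !in_set1 (can_eq phiK).
Qed.

Hypothesis psiK : cancel psi phi.

Lemma morph_weak_le x y : weak_le S2 (phi x) (phi y) = weak_le S1 x y.
Proof.
apply/subsetP/subsetP=> sub r; first by rewrite -!morph_inv_set => /sub.
by rewrite -(psiK r) !morph_inv_set => /sub.
Qed.

Lemma morph_alt_word s t k : phi (alt_word s t k) = alt_word (phi s) (phi t) k.
Proof.
elim: k s t => [|k IHk] s t; last by rewrite !alt_wordS phiM IHk.
by apply: (mulgI (phi 1)); rewrite -phiM !mulg1.
Qed.

Lemma morph_cambrian (O1 : rel gT1) (O2 : rel gT2) x y :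
  (forall s t, O1 s t -> O2 (phi s) (phi t) /\ #[phi s * phi t] = #[s * t]) ->
  cambrian_cong S1 O1 x y -> cambrian_cong S2 O2 (phi x) (phi y).
Proof.
move=> phiO xy R cR gR; apply: (xy (fun u v => R (phi u) (phi v))).
  exact: (lattice_congruence_mono psiK morph_weak_le cR).
by move=> s t /phiO[Ost ost]; rewrite morph_alt_word -ost; apply: gR.
Qed.

End Transport.

(** The diagram records only orders above 2; otherwise the order is 1 for equal and 2 for distinct
    reflections. *)
Lemma diag_iso_order (gT1 gT2 : finGroupType) (S1 : {set gT1}) (S2 : {set gT2})
  (O1 : rel gT1) (O2 : rel gT2) (sigma : gT1 -> gT2) :
  coxeter_system S1 -> coxeter_system S2 -> diag_iso S1 O1 S2 O2 sigma ->
  {in S1 &, forall s t, #[sigma s * sigma t] = #[s * t]}.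
Proof.
move=> cS1 cS2 [inj im m2 m _] s t sS tS.
have sgS r : r \in S1 -> sigma r \in S2 by move=> rS; rewrite -im imset_f.
have [<-|st] := eqVneq s t.
  by rewrite (simple_mulgg cS1 sS) (simple_mulgg cS2 (sgS s sS)) !order1.
have [st2|st2] := boolP (2 < #[s * t]); first exact: m.
have sst : sigma s != sigma t by apply: contraNneq st => /inj->.
have gt1 := order_gt1_simple cS1 tS st.
have gt1' := order_gt1_simple cS2 (sgS t tS) sst.
have st2' := st2; rewrite m2 // in st2'; rewrite -!leqNgt in st2 st2'.
by apply/eqP; rewrite eqn_leq (leq_trans st2') // (leq_trans st2).
Qed.

Lemma diag_iso_induces (gT1 gT2 : finGroupType) (S1 : {set gT1}) (S2 : {set gT2})
  (O1 : rel gT1) (O2 : rel gT2) (sigma : gT1 -> gT2) :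
  coxeter_system S1 -> coxeter_system S2 -> orientation S1 O1 -> orientation S2 O2 ->
  diag_iso S1 O1 S2 O2 sigma ->
  exists phi : gT1 -> gT2,
    [/\ group_iso phi, {in S1, phi =1 sigma} &
        quot_iso (weak_le S1) (cambrian_cong S1 O1) (weak_le S2) (cambrian_cong S2 O2) phi].
Proof.
move=> cS1 cS2 oO1 oO2 iso; have os := diag_iso_order cS1 cS2 iso.
case: iso => inj im _ _ sigmaO.
have sgS : {in S1, forall s, sigma s \in S2} by move=> s sS; rewrite -im imset_f.
(* [tau] inverts [sigma] on [S2]; its value 1 elsewhere is arbitrary. *)
have [tau tauP] : exists tau : gT2 -> gT1, forall b, b \in S2 -> tau b \in S1 /\ sigma (tau b) = b.
  apply: (fin_all_exists (P := fun b a => b \in S2 -> a \in S1 /\ sigma a = b)) => b.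
  have [|bS] := boolP (b \in S2); last by exists 1.
  by rewrite -im => /imsetP[a aS ->]; exists a.
have tauK : {in S1, cancel sigma tau}.
  by move=> s sS; have [tS tE] := tauP _ (sgS s sS); apply: inj.
have ot : {in S2 &, forall a b, #[tau a * tau b] = #[a * b]}.
  move=> a b /tauP[aS aE] /tauP[bS bE].
  by rewrite -os // aE bE.
have [phi phiM phiS] := coxeter_morph cS1 os.
have [psi psiM psiS] := coxeter_morph cS2 ot.
have phiK : cancel phi psi.
  apply: (morph_fixing_generators cS1 (h := fun x => psi (phi x))) => [x y|s sS].
    by rewrite phiM psiM.
  by rewrite phiS // psiS ?sgS // tauK.
have psiK : cancel psi phi.
  apply: (morph_fixing_generators cS2 (h := fun x => phi (psi x))) => [x y|b bS].
    by rewrite psiM phiM.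
  by have [tS tE] := tauP b bS; rewrite psiS // phiS // tE.
have phiS2 : {in S1, forall s, phi s \in S2} by move=> s sS; rewrite phiS ?sgS.
have psiS1 : {in S2, forall s, psi s \in S1} by move=> s sS; rewrite psiS //; case: (tauP s sS).
have le12 := morph_weak_le cS1 cS2 phiK phiM phiS2 psiK.
have congP x y : cambrian_cong S1 O1 x y <-> cambrian_cong S2 O2 (phi x) (phi y).
  split; first apply: (morph_cambrian cS1 cS2 phiK) => // s t Ost.
    have [sS tS _ _] := orientation_edge cS1 oO1 Ost.
    by rewrite !phiS // sigmaO // os.
  rewrite -{2}(phiK x) -{2}(phiK y).
  apply: (morph_cambrian cS2 cS1 psiK) => // a b Oab.
  have [aS bS _ _] := orientation_edge cS2 oO2 Oab.
  rewrite !psiS // ot // -sigmaO; try by case: (tauP _ aS) (tauP _ bS) => ? -> [? ->].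
  - by case: (tauP _ aS).
  - by case: (tauP _ bS).
exists phi; split=> //; first by split=> //; exists psi.
split=> // [y|x y]; first by exists (psi y); rewrite psiK => R [].
split=> [[u [v [xu yv uv]]]|[u [v [xu yv uv]]]].
  by exists (phi u), (phi v); rewrite le12; split=> //; apply/congP.
by exists (psi u), (psi v); rewrite -le12 !psiK; split=> //; apply/congP; rewrite psiK.
Qed.

Section Composition.

Variables (gT1 gT2 gT3 : finGroupType).
Variables (le1 : rel gT1) (le2 : rel gT2) (le3 : rel gT3).
Variables (R1 : gT1 -> gT1 -> Prop) (R2 : gT2 -> gT2 -> Prop) (R3 : gT3 -> gT3 -> Prop).
Hypothesis R3tr : forall x y z, R3 x y -> R3 y z -> R3 x z.
Variables (f : gT1 -> gT2) (g : gT2 -> gT3).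

Lemma quot_iso_anti_comp : quot_iso le1 R1 le2 R2 f -> quot_anti_iso le2 R2 le3 R3 g ->
  quot_anti_iso le1 R1 le3 R3 (g \o f).
Proof.
move=> [Rf surf lef] [Rg surg leg]; split=> [x y|z|x y] /=.
- by split=> [/Rf/Rg|/Rg/Rf].
- have [y yz] := surg z; have [x xy] := surf y; exists x.
  by apply: R3tr yz; apply/Rg.
- by split=> [/lef/leg|/leg/lef].
Qed.

Lemma quot_anti_anti_comp : quot_anti_iso le1 R1 le2 R2 f -> quot_anti_iso le2 R2 le3 R3 g ->
  quot_iso le1 R1 le3 R3 (g \o f).
Proof.
move=> [Rf surf lef] [Rg surg leg]; split=> [x y|z|x y] /=.
- by split=> [/Rf/Rg|/Rg/Rf].
- have [y yz] := surg z; have [x xy] := surf y; exists x.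
  by apply: R3tr yz; apply/Rg.
- by split=> [/lef/leg|/leg/lef].
Qed.

End Composition.

(** * Recovering the directed diagram from the Cambrian lattice *)

Section Restriction.

Variables (gT1 gT2 : finGroupType) (S1 : {set gT1}) (S2 : {set gT2}).
Variables (O1 : rel gT1) (O2 : rel gT2).
Hypotheses (cS1 : coxeter_system S1) (cS2 : coxeter_system S2).
Hypotheses (oO1 : orientation S1 O1) (oO2 : orientation S2 O2).
Local Notation T1 := (cambrian_cong S1 O1).
Local Notation T2 := (cambrian_cong S2 O2).
Local Notation q1 := (quot_le (weak_le S1) T1).
Local Notation q2 := (quot_le (weak_le S2) T2).
Let cT1 : lattice_congruence (weak_le S1) T1 := cambrian_lattice_congruence S1 O1.
Let cT2 : lattice_congruence (weak_le S2) T2 := cambrian_lattice_congruence S2 O2.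

Variable f : gT1 -> gT2.
Hypothesis isof : quot_iso (weak_le S1) T1 (weak_le S2) T2 f.

(** [f s] is not the bottom, so it is above some simple [a]. A preimage of [a] is below [s] and not
    the bottom, hence in the class of [s]. *)
Lemma quot_iso_atom s : s \in S1 -> exists2 a, a \in S2 & T2 (f s) a.
Proof.
move=> sS; have [ff surf lef] := isof.
have [R2xx R2sym R2tr _ _] := cT2; have [R1xx R1sym R1tr _ _] := cT1.
have f1 : T2 (f 1) 1.
  have [x fx] := surf 1; apply: (quot_le_anti cT2).
    apply: (quot_le_cong cT2 (R2xx _) fx); apply/lef.
    by apply: (quot_le_of_le cT1); apply: weak_le1.
  by apply: (quot_le_of_le cT2); apply: weak_le1.
have fs1 : f s != 1.
  apply/eqP=> fs; case/eqP: (simple_neq1 cS1 sS).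
  by apply: (cambrian_eq1 cS1 oO1); apply/ff; rewrite fs; apply: R2sym.
have [a aS afs] := inv_set_descent cS2 fs1.
exists a => //; have [x fx] := surf a.
have xs : q1 x s.
  apply/lef; apply: (quot_le_cong cT2 (R2sym _ _ fx) (R2xx _)).
  by apply/(quot_le_simple cS2 oO2).
have x1 : x != 1.
  apply/eqP=> x1; rewrite x1 in fx; case/eqP: (simple_neq1 cS2 aS).
  by apply: (cambrian_eq1 cS2 oO2); apply: R2tr (R2sym _ _ fx) f1.
apply: R2tr fx; apply/ff; apply: R1sym.
exact: (quot_le_atom cS1 oO1 sS xs x1).
Qed.

Section Edge.

Variables (s t : gT1) (a b : gT2).
Hypotheses (aS : a \in S2) (bS : b \in S2) (fsa : T2 (f s) a) (ftb : T2 (f t) b).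
Hypothesis Ost : O1 s t.

Let sS : s \in S1. Proof. by case: (orientation_edge cS1 oO1 Ost). Qed.
Let tS : t \in S1. Proof. by case: (orientation_edge cS1 oO1 Ost). Qed.

Lemma quot_iso_mem_inv u c x : u \in S1 -> c \in S2 -> T2 (f u) c ->
  (c \in inv_set S2 (f x)) = (u \in inv_set S1 x).
Proof.
move=> uS cS fuc; have [_ _ lef] := isof; have [R2xx R2sym _ _ _] := cT2.
apply/idP/idP.
  move/(quot_le_simple cS2 oO2 _ cS)/(quot_le_cong cT2 (R2sym _ _ fuc) (R2xx _))/lef.
  by move/(quot_le_simple cS1 oO1 _ uS).
move/(quot_le_simple cS1 oO1 _ uS)/lef/(quot_le_cong cT2 fuc (R2xx _)).
by move/(quot_le_simple cS2 oO2 _ cS).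
Qed.

(** In the quotient the top of a polygon is the join of its two atoms, which an isomorphism
    preserves. *)
Lemma quot_iso_longest :
  T2 (f (alt_word s t #[s * t])) (alt_word a b #[a * b]).
Proof.
have [_ surf lef] := isof; have [R2xx R2sym _ _ _] := cT2.
apply: (quot_le_anti cT2).
  have [x fx] := surf (alt_word a b #[a * b]).
  have dx := cambrian_descents cS2 oO2 fx.
  apply: (quot_le_cong cT2 (R2xx _) fx); apply/lef.
  apply: (quot_le_of_le cT1); apply: alt_word_longest_le => //.
    by rewrite -(quot_iso_mem_inv _ sS aS fsa) dx // first_in_alt_word // order_gt0.
  by rewrite -(quot_iso_mem_inv _ tS bS ftb) dx // last_in_alt_word.
apply: (quot_le_of_le cT2); apply: alt_word_longest_le => //.
  by rewrite (quot_iso_mem_inv _ sS aS fsa) first_in_alt_word // order_gt0.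
by rewrite (quot_iso_mem_inv _ tS bS ftb) last_in_alt_word.
Qed.

Lemma quot_iso_side k : 0 < k < #[s * t] ->
  exists2 j, 0 < j < #[a * b] & T2 (f (alt_word s t k)) (alt_word a b j).
Proof.
case/andP=> k0 km; have [_ _ lef] := isof; have [R2xx _ _ _ _] := cT2.
apply: (cambrian_interval cS2 oO2) => //.
- by rewrite (quot_iso_mem_inv _ sS aS fsa) first_in_alt_word // ltnW.
- by rewrite (quot_iso_mem_inv _ tS bS ftb) last_in_alt_word ?(ltnW km) // ltn_eqF.
apply: (quot_le_cong cT2 (R2xx _) quot_iso_longest); apply/lef.
by apply: (quot_le_of_le cT1); apply: alt_word_le => //; apply: ltnW.
Qed.

Lemma quot_iso_edge : O2 a b /\ #[s * t] <= #[a * b].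
Proof.
have [ff _ _] := isof; have [_ R2sym R2tr _ _] := cT2.
have [_ _ st m2] := orientation_edge cS1 oO1 Ost.
have Ots : ~~ O1 t s by rewrite -(oO1.2 s t sS tS m2).
have sep k l : k < #[s * t] -> l < #[s * t] ->
    T2 (f (alt_word s t k)) (f (alt_word s t l)) -> k = l.
  by move=> km lm /ff; apply: (alt_word_separated cS1 oO1 sS tS st Ots km lm).
split.
  (* Without the edge [a -> b] the side through [a] is one class, so [s] and [s t] would have
     congruent images although they are separated. *)
  apply: contraT => Oab.
  have collapse k : 0 < k < #[s * t] -> T2 (f (alt_word s t k)) a.
    case/quot_iso_side=> j jm fj; apply: R2tr fj _; apply: R2sym.
    exact: alt_word_contracted.
  suff: 1%N = 2 by [].
  apply: (sep 1%N 2) => //; first exact: ltnW.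
  exact: R2tr (collapse 1%N (ltnW m2)) (R2sym _ _ (collapse 2 m2)).
(* The [m - 1] classes on the side of [s] inject into those on the side of [a]; ordinals start at 0,
   so [i] stands for the word of length [i + 1]. *)
have [j jP] : exists j : 'I_#[s * t].-1 -> 'I_#[a * b].-1,
    forall i : 'I_#[s * t].-1, T2 (f (alt_word s t i.+1)) (alt_word a b (j i).+1).
  apply: (fin_all_exists (P := fun (i : 'I__) (l : 'I__) => T2 (f (alt_word s t i.+1)) (alt_word a b l.+1))).
  move=> i; case: (@quot_iso_side i.+1) => [|[|l] // lm h].
    by rewrite /= -ltn_predRL.
  have lm' : l < #[a * b].-1 by rewrite ltn_predRL.
  by exists (Ordinal lm').
have: injective j.
  have lt_m (l : 'I_#[s * t].-1) : l.+1 < #[s * t] by rewrite -ltn_predRL.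
  move=> i i' ij; apply/val_inj/succn_inj/(sep _ _ (lt_m i) (lt_m i')).
  have := jP i; rewrite ij => ji; exact: (R2tr _ _ _ ji (R2sym _ _ (jP i'))).
move/leq_card; rewrite !card_ord.
by rewrite -ltnS !prednK ?order_gt0.
Qed.

End Edge.

End Restriction.

Lemma quot_iso_restricts (gT1 gT2 : finGroupType) (S1 : {set gT1}) (S2 : {set gT2})
  (O1 : rel gT1) (O2 : rel gT2) (f : gT1 -> gT2) :
  coxeter_system S1 -> coxeter_system S2 -> orientation S1 O1 -> orientation S2 O2 ->
  quot_iso (weak_le S1) (cambrian_cong S1 O1) (weak_le S2) (cambrian_cong S2 O2) f ->
  exists sigma : gT1 -> gT2,
    diag_iso S1 O1 S2 O2 sigma /\ {in S1, forall s, cambrian_cong S2 O2 (f s) (sigma s)}.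
Proof.
move=> cS1 cS2 oO1 oO2 isof; have [ff surf lef] := isof.
have [R1xx R1sym R1tr _ _] := cambrian_lattice_congruence S1 O1.
have [R2xx R2sym R2tr _ _] := cambrian_lattice_congruence S2 O2.
(* An inverse on representatives: [quot_iso_edge] bounds labels one way only, and applying it to [g]
   gives the other bound and reflects edges. *)
have [g gP] := fin_all_exists surf.
have isog : quot_iso (weak_le S2) (cambrian_cong S2 O2) (weak_le S1) (cambrian_cong S1 O1) g.
  split=> [x y|x|x y].
  - split=> [xy|/ff h]; last by apply: R2tr (R2sym _ _ (gP x)) (R2tr _ _ _ h (gP y)).
    by apply/ff; apply: R2tr (gP x) (R2tr _ _ _ xy (R2sym _ _ (gP y))).
  - by exists (f x); apply/ff.
  - have c2 := cambrian_lattice_congruence S2 O2.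
    split=> [h|/lef]; last exact: (quot_le_cong c2 (gP x) (gP y)).
    by apply/lef; apply: (quot_le_cong c2 (R2sym _ _ (gP x)) (R2sym _ _ (gP y))).
have [sigma sigmaP] : exists sigma : gT1 -> gT2, forall s, s \in S1 ->
    sigma s \in S2 /\ cambrian_cong S2 O2 (f s) (sigma s).
  apply: (fin_all_exists (P := fun s a => s \in S1 -> a \in S2 /\ cambrian_cong S2 O2 (f s) a)) => s.
  have [sS|] := boolP (s \in S1); last by exists 1.
  by have [a aS fa] := quot_iso_atom cS1 cS2 oO1 oO2 isof sS; exists a.
exists sigma; split; last by move=> s /sigmaP[].
have gsigma s : s \in S1 -> cambrian_cong S1 O1 (g (sigma s)) s.
  by move=> /sigmaP[_ h]; apply/ff; apply: R2tr (gP _) (R2sym _ _ h).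
have edge s t : s \in S1 -> t \in S1 -> O1 s t ->
    O2 (sigma s) (sigma t) /\ #[s * t] <= #[sigma s * sigma t].
  move=> /sigmaP[aS fa] /sigmaP[bS fb].
  exact: (quot_iso_edge cS1 cS2 oO1 oO2 isof aS bS fa fb).
have edge' s t : s \in S1 -> t \in S1 -> O2 (sigma s) (sigma t) ->
    O1 s t /\ #[sigma s * sigma t] <= #[s * t].
  move=> sS tS.
  exact: (quot_iso_edge cS2 cS1 oO2 oO1 isog sS tS (gsigma s sS) (gsigma t tS)).
have or1 s t : s \in S1 -> t \in S1 -> 2 < #[s * t] -> O1 s t \/ O1 t s.
  by move=> sS tS /(oO1.2 s t sS tS) ->; case: (O1 t s); [right | left].
have or2 s t : s \in S2 -> t \in S2 -> 2 < #[s * t] -> O2 s t \/ O2 t s.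
  by move=> sS tS /(oO2.2 s t sS tS) ->; case: (O2 t s); [right | left].
have order_eq s t : s \in S1 -> t \in S1 -> O1 s t -> #[sigma s * sigma t] = #[s * t].
  move=> sS tS Ost; have [Oab le12] := edge s t sS tS Ost.
  by have [_ le21] := edge' s t sS tS Oab; apply/eqP; rewrite eqn_leq le21.
have order_eq' s t : s \in S1 -> t \in S1 -> 2 < #[s * t] -> #[sigma s * sigma t] = #[s * t].
  move=> sS tS /(or1 s t sS tS)[]; first exact: order_eq.
  by move/(order_eq t s tS sS); rewrite order_mulC (order_mulC t s).
split=> [s t sS tS st||s t sS tS|//|s t sS tS].
- have [[_ fs] [_ ft]] := (sigmaP s sS, sigmaP t tS).
  apply: (cambrian_simple_inj cS1 oO1 sS tS); apply/ff.
  by apply: R2tr fs _; rewrite st; apply: R2sym.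
- apply/eqP; rewrite eqEsubset; apply/andP; split.
    by apply/subsetP=> _ /imsetP[s /sigmaP[sS _] ->].
  apply/subsetP=> a aS; have [s sS gs] := quot_iso_atom cS2 cS1 oO2 oO1 isog aS.
  have [bS fs] := sigmaP s sS.
  suff -> : a = sigma s by apply: imset_f.
  apply: (cambrian_simple_inj cS2 oO2 aS bS); move/ff: gs => gs.
  exact: (R2tr _ _ _ (R2tr _ _ _ (R2sym _ _ (gP a)) gs) fs).
- apply/idP/idP=> [h|]; first by rewrite order_eq'.
  have [[aS _] [bS _]] := (sigmaP s sS, sigmaP t tS).
  move=> h; case: (or2 _ _ aS bS h) => /edge'[] // Ost _.
    by rewrite -order_eq.
  by rewrite order_mulC -order_eq // order_mulC.
- by apply/idP/idP=> [/edge'[]|/edge[]].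
Qed.

Theorem theorem3p5 (gT1 gT2 : finGroupType)
  (S1 : {set gT1}) (S2 : {set gT2}) (O1 : rel gT1) (O2 : rel gT2) :
  coxeter_system S1 -> coxeter_system S2 ->
  orientation S1 O1 -> orientation S2 O2 ->
  [/\
   (* a diagram isomorphism induces a Cambrian lattice isomorphism *)
   (forall sigma : gT1 -> gT2, diag_iso S1 O1 S2 O2 sigma ->
      exists phi : gT1 -> gT2,
        [/\ group_iso phi, {in S1, phi =1 sigma} &
            quot_iso (weak_le S1) (cambrian_cong S1 O1)
                     (weak_le S2) (cambrian_cong S2 O2) phi]),
   (* a diagram anti-isomorphism induces a Cambrian lattice anti-isomorphism *)
   (forall sigma : gT1 -> gT2, diag_anti_iso S1 O1 S2 O2 sigma ->
      exists phi : gT1 -> gT2,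
        [/\ group_iso phi, {in S1, phi =1 sigma} &
            quot_anti_iso (weak_le S1) (cambrian_cong S1 O1)
                          (weak_le S2) (cambrian_cong S2 O2)
                          (fun x => phi x * longest S2)%g]),
   (* a Cambrian lattice isomorphism restricts on atoms to a diagram isomorphism *)
   (forall f : gT1 -> gT2,
      quot_iso (weak_le S1) (cambrian_cong S1 O1)
               (weak_le S2) (cambrian_cong S2 O2) f ->
      exists sigma : gT1 -> gT2,
        diag_iso S1 O1 S2 O2 sigma /\
        {in S1, forall s, cambrian_cong S2 O2 (f s) (sigma s)}) &
   (* a Cambrian lattice anti-isomorphism restricts on atoms (sent to the
      coatoms [s w0]) to a diagram anti-isomorphism *)
   (forall f : gT1 -> gT2,
      quot_anti_iso (weak_le S1) (cambrian_cong S1 O1)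
                    (weak_le S2) (cambrian_cong S2 O2) f ->
      exists sigma : gT1 -> gT2,
        diag_anti_iso S1 O1 S2 O2 sigma /\
        {in S1, forall s, cambrian_cong S2 O2 (f s) (sigma s * longest S2)%g})].

Proof.
move=> cS1 cS2 oO1 oO2.
have oO2' := orientation_op oO2.
have [_ _ tr2 _ _] := cambrian_lattice_congruence S2 O2.
have [_ _ tr2' _ _] := cambrian_lattice_congruence S2 (fun s t => O2 t s).
split=> [sigma iso|sigma iso|f isof|f isof].
- exact: (diag_iso_induces cS1 cS2 oO1 oO2 iso).
(* By conversion, [iso] is a diagram isomorphism onto the opposite orientation. *)
- have [phi [isophi phiS quot]] := diag_iso_induces cS1 cS2 oO1 oO2' iso.
  exists phi; split=> //.
  exact: (quot_iso_anti_comp tr2 quot (cambrian_quot_anti_iso cS2 oO2)).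
- exact: (quot_iso_restricts cS1 cS2 oO1 oO2 isof).
have iso := quot_anti_anti_comp tr2' isof (cambrian_quot_anti_iso cS2 oO2').
have [sigma [isos fs]] := quot_iso_restricts cS1 cS2 oO1 oO2' iso.
(* [sigma s] represents [f s * w0] for the opposite orientation; multiplying by [w0] again returns
   to [O2] and gives the coatom. *)
exists sigma; split=> // s /fs /(cambrian_dual cS2 oO2').
by rewrite /= (mulw0K cS2).
Qed.
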